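(* Let $c\colon E^1\to G$ be a labeling of a row-finite directed graph $E=(E^0,E^1,r,s)$ by a discrete group $G$, and let $\gamma$ be the action of $G$ on $C^*(E\times_c G)$ given by $\gamma_t(s_{(f,s)})=s_{(f,st^{-1})}$ and $\gamma_t(p_{(v,s)})=p_{(v,st^{-1})}$ for $s,t\in G$, $f\in E^1$, $v\in E^0$. Then the full crossed product satisfies $$C^*(E\times_cG)\times_{\gamma}G\cong C^*(E)\otimes\mathcal{K}(\ell^2(G)).$$
   Context: A directed graph $E=(E^0,E^1,r,s)$ consists of a set $E^0$ of vertices, a set $E^1$ of edges, and range and source maps $r,s\colon E^1\to E^0$. It is row-finite if $s^{-1}(v)$ is finite for every $v\in E^0$; sources and sinks are allowed (a sink is a vertex emitting no edges). A Cuntz-Krieger $E$-family in a $C^*$-algebra $B$ is a collection $\{t_f,q_v\mid f\in E^1,v\in E^0\}$ of partial isometries $t_f$ and mutually orthogonal projections $q_v$ in $B$ such that $t_f^*t_f=q_{r(f)}$ for each $f\in E^1$ and $q_v=\sum_{s(f)=v}t_ft_f^*$ for every $v\in E^0$ which is not a sink. $C^*(E)$ is the universal $C^*$-algebra generated by a Cuntz-Krieger $E$-family, and its canonical generators are denoted $\{s_f,p_v\}$. A labeling of $E$ by a group $G$ is a function $c\colon E^1\to G$. The skew-product graph $E\times_c G$ has vertex set $E^0\times G$, edge set $E^1\times G$, and range and source maps $r(f,t)=(r(f),t)$, $s(f,t)=(s(f),c(f)t)$. It is row-finite when $E$ is. $\mathcal{K}(\ell^2(G))$ denotes the compact operators on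 $\ell^2(G)$, and $\times_{\gamma}$ denotes the full (universal) crossed product. *)

(* Defs.v *)
From HB Require Import structures.
From mathcomp Require Import all_boot all_order all_algebra.
From mathcomp Require Import complex.
From mathcomp Require Import all_classical all_reals all_analysis.
From mathcomp Require Import ring lra.
From mathcomp Require summability.

Set Implicit Arguments.
Unset Strict Implicit.
Unset Printing Implicit Defensive.

Import Order.TTheory GRing.Theory Num.Theory.
Import numFieldNormedType.Exports.

Local Open Scope classical_set_scope.
Local Open Scope ring_scope.

(* C*-algebras are complex and not necessarily unital. *)
HB.mixin Record CompleteNormedModule_isCStar (R : realType) A
    & CompleteNormedModule R[i] A := {
  cmul : A -> A -> A ;
  cstar : A -> A ;
  cmulA : associative cmul ;
  cmulDl : left_distributive cmul +%R ;
  cmulDr : right_distributive cmul +%R ;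
  cmulZl : forall (k : R[i]) (a b : A), cmul (k *: a) b = k *: cmul a b ;
  cmulZr : forall (k : R[i]) (a b : A), cmul a (k *: b) = k *: cmul a b ;
  cstarK : involutive cstar ;
  cstarD : {morph cstar : a b / a + b} ;
  cstarZ : forall (k : R[i]) (a : A), cstar (k *: a) = (k^*)%R *: cstar a ;
  cstarM : forall a b : A, cstar (cmul a b) = cmul (cstar b) (cstar a) ;
  cnormM : forall a b : A, `|cmul a b| <= `|a| * `|b| ;
  cnorm_star : forall a : A, `|cmul (cstar a) a| = `|a| ^+ 2
}.

#[short(type="cstarType")]
HB.structure Definition CStarAlgebra (R : realType) :=
  {A of CompleteNormedModule R[i] A & CompleteNormedModule_isCStar R A}.

Declare Scope cstar_scope.
Delimit Scope cstar_scope with CS.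
Notation "a \* b" := (cmul a b) : cstar_scope.
Notation "a ^*" := (cstar a) : cstar_scope.
Local Open Scope cstar_scope.

Section CStarBasics.
Context {R : realType}.
Implicit Types A B : cstarType R.

Definition star_hom A B (phi : A -> B) : Prop :=
  [/\ linear phi,
      forall a b, phi (a \* b) = phi a \* phi b &
      forall a, phi (a^*) = (phi a)^*].

Definition star_isomorphic A B : Prop :=
  exists phi : A -> B, star_hom phi /\ bijective phi.

Definition closed_subspace A (V : set A) : Prop :=
  [/\ closed V, V 0 & forall (k : R[i]) a b, V a -> V b -> V (k *: a + b)].

Definition closed_star_subalgebra A (V : set A) : Prop :=
  [/\ closed_subspace V,
      forall a b, V a -> V b -> V (a \* b) &
      forall a, V a -> V (a^*)].

Definition closed_span_full A (S : set A) : Prop :=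
  forall V, closed_subspace V -> S `<=` V -> V = setT.

Definition cstar_generates A (S : set A) : Prop :=
  forall V, closed_star_subalgebra V -> S `<=` V -> V = setT.

Definition projection A (p : A) : Prop := p \* p = p /\ p^* = p.

Definition partial_isometry A (t : A) : Prop := (t \* t^*) \* t = t.

End CStarBasics.

Record digraph := Digraph {
  vertex : choiceType ;
  edge : choiceType ;
  rng : edge -> vertex ;
  src : edge -> vertex
}.

Definition row_finite (E : digraph) : Prop :=
  forall v : vertex E, finite_set [set f : edge E | src f = v].

Definition is_sink (E : digraph) (v : vertex E) : Prop :=
  forall f : edge E, src f <> v.

Definition skew_product (E : digraph) (G : groupType) (c : edge E -> G) :
    digraph :=
  @Digraph (vertex E * G)%type (edge E * G)%type
    (fun ft => (rng ft.1, ft.2))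
    (fun ft => (src ft.1, (c ft.1 * ft.2)%g)).

Section GraphAlgebra.
Context {R : realType}.

Definition CK_family (E : digraph) (B : cstarType R)
    (t : edge E -> B) (q : vertex E -> B) : Prop :=
  [/\ forall f, partial_isometry (t f),
      forall v, projection (q v),
      forall v w, v <> w -> q v \* q w = 0,
      forall f, (t f)^* \* t f = q (rng f) &
      forall v, ~ is_sink v ->
        q v = \sum_(f \in [set f | src f = v]) (t f \* (t f)^*)].

(* [A], with canonical generators [s] and [p], is the universal C*-algebra
   generated by a Cuntz-Krieger E-family; uniqueness of [phi] follows from
   generation. *)
Definition is_graph_algebra (E : digraph) (A : cstarType R)
    (s : edge E -> A) (p : vertex E -> A) : Prop :=
  [/\ CK_family s p,
      cstar_generates (range s `|` range p) &
      forall (B : cstarType R) (t : edge E -> B) (q : vertex E -> B),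
        CK_family t q ->
        exists phi : A -> B,
          [/\ star_hom phi, forall f, phi (s f) = t f &
              forall v, phi (p v) = q v]].

End GraphAlgebra.

Section CrossedProduct.
Context {R : realType} {G : groupType}.

Definition is_action (A : cstarType R) (g : G -> A -> A) : Prop :=
  [/\ forall t, star_hom (g t),
      forall a, g 1%g a = a &
      forall s t a, g (s * t)%g a = g s (g t a)].

(* A *-homomorphism of the convolution *-algebra C_c(G, A) into B, given on
   the spanning elements a delta_t by a delta_t |-> j t a.  In C_c(G, A),
   (a delta_s)(b delta_t) = a g_s(b) delta_{st} and
   (a delta_t)^* = g_{t^-1}[a^*] delta_{t^-1}. *)
Definition twisted_hom (A : cstarType R) (g : G -> A -> A) (B : cstarType R)
    (j : G -> A -> B) : Prop :=
  [/\ forall t, linear (j t),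
      forall s t a b, j s a \* j t b = j (s * t)%g (a \* g s b) &
      forall t a, (j t a)^* = j (t^-1)%g (g (t^-1)%g (a^*))].

(* The full crossed product is the enveloping C*-algebra of C_c(G, A), i.e. its
   completion in the supremum of the C*-seminorms of all its
   *-representations. *)
Definition is_full_crossed_product (A : cstarType R) (g : G -> A -> A)
    (D : cstarType R) (j : G -> A -> D) : Prop :=
  [/\ twisted_hom g j,
      closed_span_full [set j t a | t in [set: G] & a in [set: A]] &
      forall (B : cstarType R) (h : G -> A -> B), twisted_hom g h ->
        exists phi : D -> B,
          star_hom phi /\ forall t a, phi (j t a) = h t a].

End CrossedProduct.

Section L2Space.
Context {R : realType} {G : groupType}.
Implicit Types (x y : G -> R[i]) (k : R[i]).

Definition sqmod (z : R[i]) : R := complex.Re z ^+ 2 + complex.Im z ^+ 2.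

Definition sqsum x : \bar R := \esum_(g in [set: G]) (sqmod (x g))%:E.

Definition sqsummable : pred (G -> R[i]) := fun x => (sqsum x < +oo)%E.

Lemma sqmod_ge0 z : 0 <= sqmod z.
Proof. by rewrite /sqmod addr_ge0// sqr_ge0. Qed.

Lemma sqsum_ge0 x : (0 <= sqsum x)%E.
Proof. by apply: esum_ge0 => g _; rewrite lee_fin sqmod_ge0. Qed.

Lemma sqmodM k z : sqmod (k * z) = sqmod k * sqmod z.
Proof. by case: k z => [a b] [c d]; rewrite /sqmod/=; ring. Qed.

Lemma sqmodD (t : R) (z w : R[i]) : 0 < t ->
  sqmod (z + w) <= (1 + t) * sqmod z + (1 + t^-1) * sqmod w.
Proof.
move=> t0; case: z w => [a b] [c d]; rewrite /sqmod/=.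
have t1 : t * t^-1 = 1 by rewrite divff// gt_eqF.
have u0 : 0 < t^-1 by rewrite invr_gt0.
have H (u v : R) : 2 * (u * v) <= t * u ^+ 2 + t^-1 * v ^+ 2.
  have -> : 2 * (u * v) = t * u ^+ 2 + t^-1 * v ^+ 2
      - t^-1 * (t * u - v) ^+ 2.
    have -> : t^-1 * (t * u - v) ^+ 2 =
      (t * t^-1) * t * u ^+ 2 - 2 * (t * t^-1) * (u * v) + t^-1 * v ^+ 2
      by ring.
    by rewrite t1; ring.
  by rewrite gerBl mulr_ge0 ?sqr_ge0// ltW.
have := H a c; have := H b d; lra.
Qed.

Lemma esum_scale_le (a : R) (f : G -> R) : 0 <= a -> (forall g, 0 <= f g) ->
  (\esum_(g in [set: G]) (a * f g)%:E <=
   a%:E * \esum_(g in [set: G]) (f g)%:E)%E.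
Proof.
move=> a0 f0; apply: ge_ereal_sup => _ [F [fF _] <-].
under eq_fsbigr do rewrite EFinM.
rewrite -ge0_mule_fsumr; last by move=> g; rewrite lee_fin.
apply: lee_wpmul2l; first by rewrite lee_fin.
by apply: ereal_sup_ubound; exists F.
Qed.

Lemma sqsumZ_le k x : (sqsum (k *: x) <= (sqmod k)%:E * sqsum x)%E.
Proof.
rewrite /sqsum.
under eq_esum do rewrite [(k *: x) _]/(k * x _) sqmodM.
by apply: esum_scale_le => [|g]; exact: sqmod_ge0.
Qed.

Lemma sqsumD_le (t : R) x y : 0 < t ->
  (sqsum (x + y)%R <= (1 + t)%:E * sqsum x + (1 + t^-1)%:E * sqsum y)%E.
Proof.
move=> t0; have u0 : 0 < t^-1 by rewrite invr_gt0.
have p1 : 0 <= 1 + t by rewrite addr_ge0// ltW.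
have p2 : 0 <= 1 + t^-1 by rewrite addr_ge0// ltW.
apply: (@le_trans _ _ (\esum_(g in [set: G])
  (((1 + t) * sqmod (x g))%:E + ((1 + t^-1) * sqmod (y g))%:E))%E).
  by apply: le_esum => g _; rewrite lee_fin; exact: sqmodD.
rewrite esumD; try by move=> g _; rewrite lee_fin mulr_ge0// sqmod_ge0.
by apply: leeD; apply: esum_scale_le => // g; exact: sqmod_ge0.
Qed.

Lemma sqsummable_closed : subsemimod_closed sqsummable.
Proof.
split; first split.
- rewrite unfold_in /sqsum esum1 ?ltry// => g _.
  by rewrite /sqmod/= expr0n/= addr0.
- move=> x y; rewrite !unfold_in => hx hy.
  apply: le_lt_trans (sqsumD_le _ _ ltr01) _.
  by rewrite lte_add_pinfty// lte_mul_pinfty// lee_fin addr_ge0// invr_ge0.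
- move=> k x; rewrite !unfold_in => hx.
  apply: le_lt_trans (sqsumZ_le _ _) _.
  by rewrite lte_mul_pinfty// lee_fin sqmod_ge0.
Qed.

End L2Space.

Section L2Norm.
Context (R : realType) (G : groupType).

Definition l2 := {x : G -> R[i] | @sqsummable R G x}.

HB.instance Definition _ := [isSub of l2 for @sval _ _].
HB.instance Definition _ := [Choice of l2 by <:].
HB.instance Definition _ := GRing.SubChoice_isSubLmodule.Build
  R[i] (G -> R[i]) (@sqsummable R G) l2 (@sqsummable_closed R G).

Implicit Types x y : l2.

Definition l2normr x : R := Num.sqrt (fine (sqsum (\val x))).

Definition l2norm x : R[i] := (l2normr x)%:C%C.

Lemma sqsum_fin x : sqsum (\val x) \is a fin_num.
Proof. by rewrite ge0_fin_numE ?sqsum_ge0//; exact: (valP x). Qed.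

Lemma l2normr_ge0 x : 0 <= l2normr x. Proof. exact: sqrtr_ge0. Qed.

Lemma l2normrE x : sqsum (\val x) = (l2normr x ^+ 2)%:E.
Proof. by rewrite sqr_sqrtr ?fineK ?sqsum_fin// fine_ge0// sqsum_ge0. Qed.

Lemma l2normr_eq0 x : l2normr x = 0 -> x = 0.
Proof.
move=> x0; apply/val_inj/funext => g.
have : ((sqmod (\val x g))%:E <= sqsum (\val x))%E.
  apply: ereal_sup_ubound; exists [set g]; first by split.
  by rewrite fsbig_set1.
rewrite l2normrE x0 expr0n/= lee_fin /sqmod.
case: (\val x g) => a b /= ab.
have := sqr_ge0 a; have := sqr_ge0 b => b0 a0.
have /eqP : a ^+ 2 = 0 by lra.
have /eqP : b ^+ 2 = 0 by lra.
by rewrite !sqrf_eq0 => /eqP -> /eqP ->.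
Qed.

Lemma l2normrD x y : l2normr (x + y) <= l2normr x + l2normr y.
Proof.
have [x0|x0] := eqVneq (l2normr x) 0.
  by rewrite x0 (l2normr_eq0 x0) !add0r.
have [y0|y0] := eqVneq (l2normr y) 0.
  by rewrite y0 (l2normr_eq0 y0) !addr0.
have px : 0 < l2normr x by rewrite lt_def x0 l2normr_ge0.
have py : 0 < l2normr y by rewrite lt_def y0 l2normr_ge0.
rewrite -ler_sqr ?nnegrE ?addr_ge0 ?l2normr_ge0//.
have := sqsumD_le (\val x) (\val y) (divr_gt0 py px).
rewrite -[\val x + \val y]/(\val (x + y)) !l2normrE -!EFinM -EFinD lee_fin.
move=> /le_trans; apply; rewrite le_eqVlt; apply/orP; left; apply/eqP.
by field; rewrite x0 y0.
Qed.

Lemma l2normrZ_le (k : R[i]) x :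
  l2normr (k *: x) <= Num.sqrt (sqmod k) * l2normr x.
Proof.
rewrite -ler_sqr ?nnegrE ?mulr_ge0 ?sqrtr_ge0 ?l2normr_ge0//.
rewrite exprMn [Num.sqrt (sqmod k) ^+ 2]sqr_sqrtr ?sqmod_ge0//.
have := sqsumZ_le k (\val x).
by rewrite -[k *: \val x]/(\val (k *: x)) !l2normrE -!EFinM lee_fin.
Qed.

Lemma normcE (k : R[i]) : `|k| = (Num.sqrt (sqmod k))%:C%C.
Proof. by case: k. Qed.

Lemma l2normD x y : l2norm (x + y) <= l2norm x + l2norm y.
Proof. by rewrite /l2norm -rmorphD lecR l2normrD. Qed.

Lemma l2normZ (k : R[i]) x : l2norm (k *: x) = `|k| * l2norm x.
Proof.
suff e : l2normr (k *: x) = Num.sqrt (sqmod k) * l2normr x.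
  by rewrite normcE /l2norm e -rmorphM.
have [->|k0] := eqVneq k 0.
  rewrite scale0r; have -> : sqmod (0 : R[i]) = 0.
    by rewrite /sqmod/= expr0n/= addr0.
  rewrite sqrtr0 mul0r; apply/eqP; rewrite eq_le l2normr_ge0 andbT.
  have := l2normrZ_le 0 0; rewrite scale0r.
  have -> : sqmod (0 : R[i]) = 0 by rewrite /sqmod/= expr0n/= addr0.
  by rewrite sqrtr0 mul0r.
apply/eqP; rewrite eq_le l2normrZ_le/=.
have := l2normrZ_le k^-1 (k *: x); rewrite scalerA mulVf// scale1r.
have h : Num.sqrt (sqmod k) * Num.sqrt (sqmod k^-1) = 1.
  rewrite -sqrtrM ?sqmod_ge0// -sqmodM mulfV// /sqmod/=.
  by rewrite expr1n expr0n/= addr0 sqrtr1.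
move=> /(ler_wpM2l (sqrtr_ge0 (sqmod k))).
by rewrite mulrA h mul1r.
Qed.

Lemma l2norm_eq0 x : l2norm x = 0 -> x = 0.
Proof. by move=> [] /l2normr_eq0. Qed.

HB.instance Definition _ := Lmodule_isNormed.Build R[i] l2
  l2normD l2normZ l2norm_eq0.

Definition l2dot x y : R[i] :=
  summability.sum (fun g => sval x g * ((sval y g)^*)%R : R[i]^o).

Definition compact_operator (T : l2 -> l2) : Prop :=
  linear T /\ precompact (T @` [set x | `|x| <= 1]).

(* [rho] identifies the C*-algebra [K] with the algebra of all compact
   operators on l2(G): composition, Hilbert-space adjoint, operator norm. *)
Definition is_compact_operators (K : cstarType R) (rho : K -> l2 -> l2) :
    Prop :=
  [/\ range rho = [set T | compact_operator T],
      forall (k : R[i]) a b x, rho (k *: a + b) x = k *: rho a x + rho b x,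
      forall a b x, rho (a \* b) x = rho a (rho b x),
      forall a x y, l2dot (rho (a^*) x) y = l2dot x (rho a y) &
      forall a (M : R[i]), 0 <= M ->
        (`|a| <= M <-> forall x, `|rho a x| <= M * `|x|)].

End L2Norm.

Section TensorProduct.
Context {R : realType}.

Definition linearly_independent (V : lmodType R[i]) n (b : 'I_n -> V) : Prop :=
  forall k : 'I_n -> R[i], \sum_i k i *: b i = 0 -> forall i, k i = 0.

(* [T] is a completion of the algebraic tensor product of [A] and [B] in a
   C*-norm; the fourth clause says that the *-homomorphism from the algebraic
   tensor product to [T] induced by [tens] is injective.  When [B] is nuclear,
   e.g. [B] = K(l2(G)), there is only one C*-norm, hence only one such [T] up
   to isomorphism. *)
Definition is_tensor_product (A B T : cstarType R) (tens : A -> B -> T) :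
    Prop :=
  [/\ (forall a, linear (tens a)) /\ (forall b, linear (tens^~ b)),
      forall a a' b b', tens a b \* tens a' b' = tens (a \* a') (b \* b'),
      forall a b, (tens a b)^* = tens (a^*) (b^*),
      forall n (a : 'I_n -> A) (b : 'I_n -> B), linearly_independent b ->
        \sum_i tens (a i) (b i) = 0 -> forall i, a i = 0 &
      closed_span_full [set tens a b | a in [set: A] & b in [set: B]]].

End TensorProduct.

(* Main.v *)
(* Both algebras are generated by a system of matrices [a (x) e_rs] with entries
   [a] in [C^*(E)] and [r, s] in [G].  Sending [s_(f,r)] to
   [s_f (x) e_(c(f) r, r)], together with the unitary multipliers
   [e_r |-> e_(r t^-1)], is a covariant representation, which gives
   [phi : C^*(E x_c G) x G -> C^*(E) (x) K].  Conversely the elements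
   [j (c f) s_(f, c(f)^-1)] of the crossed product form a Cuntz-Krieger
   E-family, which yields the corner [a |-> a (x) e_11] and, translating it by
   the unitaries of [G], the whole matrix system; [phi] maps one corner onto the
   other.  A *-homomorphism that is injective on the (1,1) corner is injective,
   hence isometric, and so [phi] is onto.

   The C*-algebraic facts come from one construction, the norm-convergent square
   root [1 - z] of [1 - w] for [w] selfadjoint with [|w| <= 1]: if
   [x^2 = 2 z - z^2] then [x + i (1 - z)] is unitary and so [|x| <= 1].  No
   spectral theory is used. *)
Require Import Defs.
From HB Require Import structures.
From mathcomp Require Import all_boot all_order all_algebra.
From mathcomp Require Import complex.
From mathcomp Require Import all_classical all_reals all_analysis.
From mathcomp Require Import ring lra finmap.
From mathcomp Require summability.

Set Implicit Arguments.
Unset Strict Implicit.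
Unset Printing Implicit Defensive.
Import Order.TTheory GRing.Theory Num.Theory.
Import numFieldNormedType.Exports.
Local Open Scope classical_set_scope.
Local Open Scope ring_scope.
Local Open Scope cstar_scope.
(* Arguments of [+%R] and [-%R] are parsed in [ring_scope], where these two
   notations would denote a product of functions and complex conjugation. *)
Local Notation "a \* b" := (cmul a b) : ring_scope.
Local Notation "a ^*" := (cstar a) : ring_scope.

(** * The real-valued norm *)

(** The algebras need not have units, so 1 enters only through maps such as [b |-> b - z b], and a
    unitary multiplier is a linear map [U] of the algebra with [(U a)^* U b = a^* b]. Two points
    cost more than the outline suggests. The identity [p_(src f) s_f = s_f] rests on a theorem: a
    projection that is a finite sum of projections dominates each of them. With no order theory at
    hand, this is derived from the extremality of the unit in the unit ball. Also, the tensor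
    product carries an unspecified C*-norm without a cross-norm estimate, so approximating [a (x) k]
    by finite matrices uses the bound [|a (x) k b| <= 2 |k| |a (x) b|], again obtained from
    unitaries. From then on the tensor product enters only through its matrix system, the density of
    the [a (x) e_rs] and the injectivity of [a |-> a (x) e_11]. *)

Section RealNorm.
Context {R : realType}.

(* The norm of a module over [R[i]] takes its values in [R[i]]; [nrm] is the
   same norm with values in [R]. *)
Definition nrm (V : normedModType R[i]) (a : V) : R := complex.Re `|a|.

Section Normed.
Context {V : normedModType R[i]}.
Implicit Types a b : V.

Lemma nrmE a : `|a| = (nrm a)%:C%C.
Proof.
have := normr_ge0 a; rewrite /nrm; case: (`|a|) => x y /=.
by rewrite lecE /= => /andP[/eqP -> _].
Qed.

Lemma nrm_ge0 a : 0 <= nrm a.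
Proof. by rewrite -lecR -nrmE normr_ge0. Qed.

Lemma nrm0 : nrm (0 : V) = 0. Proof. by rewrite /nrm normr0. Qed.

Lemma nrm_eq0 a : nrm a = 0 -> a = 0.
Proof. by move=> a0; apply/eqP; rewrite -normr_eq0 nrmE a0. Qed.

Lemma nrmN a : nrm (- a) = nrm a. Proof. by rewrite /nrm normrN. Qed.

Lemma nrmBC a b : nrm (a - b) = nrm (b - a).
Proof. by rewrite /nrm distrC. Qed.

Lemma nrmD a b : nrm (a + b) <= nrm a + nrm b.
Proof. by rewrite -lecR rmorphD /= -!nrmE ler_normD. Qed.

Lemma nrmB a b : nrm (a - b) <= nrm a + nrm b.
Proof. by rewrite -(nrmN b) nrmD. Qed.

Lemma nrm_dist (b a c : V) : nrm (a - c) <= nrm (a - b) + nrm (b - c).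
Proof. by apply: le_trans (nrmD _ _); rewrite addrA subrK. Qed.

Lemma nrmZ (k : R[i]) a : nrm (k *: a) = complex.Re `|k| * nrm a.
Proof.
rewrite {1}/nrm normrZ (nrmE a); case: (`|k|) => x y /=.
by rewrite mulr0 subr0.
Qed.

Lemma nrmZr (r : R) a : 0 <= r -> nrm (r%:C%C *: a) = r * nrm a.
Proof. by move=> r0; rewrite nrmZ ger0_norm ?lecR. Qed.

Lemma nrmZi a : nrm ('i *: a) = nrm a.
Proof. by rewrite nrmZ normCi mul1r. Qed.

Lemma nrm_lt a (e : R) : (`|a| < e%:C%C) = (nrm a < e).
Proof. by rewrite nrmE ltcR. Qed.

Lemma nrm_le_eps (x : R) : 0 <= x -> (forall e : R, 0 < e -> x <= e) -> x = 0.
Proof.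
move=> x0 H; apply/eqP; rewrite eq_le x0 andbT.
by apply/ler_addgt0Pl => e /H; rewrite addr0.
Qed.

Lemma nrm_small a : (forall e : R, 0 < e -> nrm a <= e) -> a = 0.
Proof. by move=> H; apply: nrm_eq0; apply: nrm_le_eps (nrm_ge0 _) H. Qed.

Lemma gt0_complex (e : R[i]) : 0 < e -> exists2 r : R, 0 < r & e = r%:C%C.
Proof.
case: e => x y; rewrite ltcE /= => /andP[/eqP -> x0]; by exists x.
Qed.

Lemma Re_normc_ge0 (k : R[i]) : 0 <= complex.Re `|k|.
Proof. by have := normr_ge0 k; case: `|k| => x y; rewrite lecE => /andP[]. Qed.

Lemma closedP (S : set V) : closed S <->
  forall a, (forall e : R, 0 < e -> exists2 b, S b & nrm (a - b) < e) -> S a.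
Proof.
split=> [cS a H|H].
  apply: cS => U /nbhs_ballP[e /= /gt0_complex[r r0 ->] eU].
  have [b Sb ab] := H r r0; exists b; split=> //; apply: eU.
  by rewrite -ball_normE /ball_ /= nrm_lt.
move=> a cla; apply: H => e e0.
have e0' : 0 < e%:C%C :> R[i] by rewrite ltcR.
have [b [Sb]] := cla _ (nbhsx_ballx a _ e0').
by rewrite -ball_normE /ball_ /= nrm_lt; exists b.
Qed.

End Normed.

Lemma complete_nrm (V : completeNormedModType R[i]) (u : nat -> V) :
  (forall e : R, 0 < e ->
     exists N, forall m n, (N <= m)%N -> (N <= n)%N -> nrm (u m - u n) < e) ->
  exists l, forall e : R, 0 < e ->
     exists N, forall n, (N <= n)%N -> nrm (u n - l) < e.
Proof.
move=> cu.
have : cauchy (u @ \oo).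
  apply: cauchy_exP => _ /gt0_complex[r r0 ->].
  have [N HN] := cu r r0; exists (u N); exists N => // n /= Nn.
  by rewrite -ball_normE /ball_ /= nrm_lt; exact: HN.
move=> /cauchy_cvg ul; exists (lim (u @ \oo)) => e e0.
have e0' : 0 < e%:C%C :> R[i] by rewrite ltcR.
have [N _ HN] := ul _ (nbhsx_ballx _ _ e0').
exists N => n Nn; have := HN n Nn.
by rewrite /= -ball_normE /ball_ /= nrm_lt nrmBC.
Qed.

End RealNorm.

Section LinearFunctions.
Context {R : realType} {V W : lmodType R[i]} {f : V -> W} (fL : linear f).

Lemma lin0 : f 0 = 0.
Proof. by have := fL (-1) 0 0; rewrite scaler0 addr0 scaleN1r addNr. Qed.

Lemma linD a b : f (a + b) = f a + f b.
Proof. by have := fL 1 a b; rewrite !scale1r. Qed.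

Lemma linZ k a : f (k *: a) = k *: f a.
Proof. by have := fL k a 0; rewrite !addr0 lin0 addr0. Qed.

Lemma linN a : f (- a) = - f a.
Proof. by rewrite -scaleN1r linZ scaleN1r. Qed.

Lemma linB a b : f (a - b) = f a - f b.
Proof. by rewrite linD linN. Qed.

Lemma lin_sum (I : Type) (r : seq I) (F : I -> V) :
  f (\sum_(i <- r) F i) = \sum_(i <- r) f (F i).
Proof.
by elim: r => [|i r IH]; rewrite ?big_nil ?lin0// !big_cons linD IH.
Qed.

End LinearFunctions.

(** * Lipschitz maps and closed sets *)

Section Limits.
Context {R : realType}.

Lemma invS_small (e : R) : 0 < e ->
  exists N, forall n, (N <= n)%N -> n.+1%:R^-1 < e.
Proof.
move=> e0; have [N _ HN] := near_infty_natSinv_lt (PosNum e0).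
by exists N => n; exact: HN.
Qed.

(** Used in place of continuity: with an explicit constant, closedness of preimages is a direct
    epsilon argument. *)
Definition lip (V W : normedModType R[i]) (f : V -> W) : Prop :=
  exists2 C : R, 0 <= C & forall a b, nrm (f a - f b) <= C * nrm (a - b).

Lemma lip_id (V : normedModType R[i]) : lip (@id V).
Proof. by exists 1 => // a b; rewrite mul1r. Qed.

Lemma lip_cst (V W : normedModType R[i]) (w : W) : lip (fun _ : V => w).
Proof. by exists 0 => // a b; rewrite subrr nrm0 mul0r. Qed.

Lemma lip_comp (U V W : normedModType R[i]) (f : V -> W) (g : U -> V) :
  lip f -> lip g -> lip (fun x => f (g x)).
Proof.
move=> [C C0 fC] [D D0 gD]; exists (C * D) => [|a b]; first exact: mulr_ge0.
by apply: le_trans (fC _ _) _; rewrite -mulrA ler_wpM2l.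
Qed.

Lemma lip_linear (V W : normedModType R[i]) (f : V -> W) (C : R) :
  linear f -> 0 <= C -> (forall a, nrm (f a) <= C * nrm a) -> lip f.
Proof. by move=> fL C0 fC; exists C => // a b; rewrite -(linB fL). Qed.

Lemma lip_sub (V W : normedModType R[i]) (f g : V -> W) :
  lip f -> lip g -> lip (fun x => f x - g x).
Proof.
move=> [C C0 fC] [D D0 gD]; exists (C + D) => [|a b]; first exact: addr_ge0.
have -> : f a - g a - (f b - g b) = (f a - f b) - (g a - g b).
  by rewrite !opprB addrACA [RHS]addrACA; congr (_ + _); rewrite addrC.
by apply: le_trans (nrmB _ _) _; rewrite mulrDl lerD.
Qed.

Lemma closed_preimage_lip (V W : normedModType R[i]) (f : V -> W) (S : set W) :
  lip f -> closed S -> closed [set x | S (f x)].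
Proof.
move=> [C C0 fC] /closedP cS; apply/closedP => a H; apply: cS => e e0.
have C1 : 0 < C + 1 by rewrite ltr_wpDl.
have [b Sb ab] := H (e / (C + 1)) (divr_gt0 e0 C1).
exists (f b) => //; apply: le_lt_trans (fC _ _) _.
apply: (@le_lt_trans _ _ ((C + 1) * nrm (a - b))).
  by rewrite ler_wpM2r ?nrm_ge0// lerDl.
by rewrite mulrC -ltr_pdivlMr.
Qed.

Lemma closed0 (V : normedModType R[i]) : closed [set x : V | x = 0].
Proof.
apply/closedP => a H; apply: nrm_small => e /H[b ->].
by rewrite subr0 => /ltW.
Qed.

Lemma closed_eq_lip (V W : normedModType R[i]) (f g : V -> W) :
  lip f -> lip g -> closed [set x | f x = g x].
Proof.
move=> lf lg; have := closed_preimage_lip (lip_sub lf lg) (@closed0 W).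
by congr closed; apply/seteqP; split=> x /= /eqP;
  [rewrite subr_eq0|rewrite -subr_eq0] => /eqP.
Qed.

Lemma closed_range_isometry (V : completeNormedModType R[i])
    (W : normedModType R[i]) (f : V -> W) :
  linear f -> (forall a, nrm (f a) = nrm a) -> closed (range f).
Proof.
move=> fL fI; apply/closedP => b H.
have /choice[u uP] (n : nat) : exists a, nrm (b - f a) < n.+1%:R^-1.
  have [|_ [a _ <-] ab] := H n.+1%:R^-1; first by rewrite invr_gt0.
  by exists a.
have [|l lP] := complete_nrm (u := u).
  move=> e e0; have [N HN] := invS_small (divr_gt0 e0 (ltr0n _ 2)).
  exists N => m n Nm Nn; rewrite -fI (linB fL).
  apply: le_lt_trans (nrm_dist b _ _) _; rewrite (splitr e) nrmBC ltrD//.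
    by apply: lt_trans (uP m) _; exact: HN.
  by apply: lt_trans (uP n) _; exact: HN.
exists l => //; apply/eqP; rewrite -subr_eq0; apply/eqP/nrm_small => e e0.
have e2 := divr_gt0 e0 (ltr0n _ 2).
have [N1 H1] := invS_small e2; have [N2 H2] := lP _ e2.
apply: ltW; apply: le_lt_trans (nrm_dist (f (u (maxn N1 N2))) _ _) _.
rewrite (splitr e) ltrD//.
  by rewrite -(linB fL) fI nrmBC; apply: H2; rewrite leq_maxr.
by rewrite nrmBC; apply: lt_trans (uP _) _; apply: H1; rewrite leq_maxl.
Qed.

End Limits.

(** * Consequences of the C*-identity *)

Section CStarArithmetic.
Context {R : realType} {A : cstarType R}.
Implicit Types a b c : A.

Lemma nrm_double a : nrm (a + a) = nrm a *+ 2.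
Proof.
rewrite -mulr2n -scaler_nat -(@rmorph_nat _ _ (real_complex R)).
by rewrite nrmZr// mulr_natl.
Qed.

Lemma cmul_linl b : linear (fun a => cmul a b).
Proof. by move=> k a c; rewrite cmulDl cmulZl. Qed.
Lemma cmul_linr a : linear (fun b => cmul a b).
Proof. by move=> k b c; rewrite cmulDr cmulZr. Qed.

Lemma cmul0x a : 0 \* a = 0. Proof. exact: (lin0 (cmul_linl a)). Qed.
Lemma cmulx0 a : a \* 0 = 0. Proof. exact: (lin0 (cmul_linr a)). Qed.
Lemma cmulNx a b : (- a) \* b = - (a \* b).
Proof. exact: (linN (cmul_linl b)). Qed.
Lemma cmulBl a b c : (a - b) \* c = a \* c - b \* c.
Proof. exact: (linB (cmul_linl c)). Qed.
Lemma cmulBr a b c : a \* (b - c) = a \* b - a \* c.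
Proof. exact: (linB (cmul_linr a)). Qed.

Lemma cstar0 : (0 : A)^* = 0.
Proof. by have := cstarZ 0 (0 : A); rewrite conjC0 !scale0r. Qed.
Lemma cstarN a : (- a)^* = - a^*.
Proof. by rewrite -scaleN1r cstarZ conjCN1 scaleN1r. Qed.
Lemma cstarB a b : (a - b)^* = a^* - b^*.
Proof. by rewrite cstarD cstarN. Qed.
Lemma cstarZr (r : R) a : (r%:C%C *: a)^* = r%:C%C *: a^*.
Proof. by rewrite cstarZ conj_Creal// complex_real. Qed.

Lemma nrmM a b : nrm (a \* b) <= nrm a * nrm b.
Proof. by rewrite -lecR rmorphM /= -!nrmE cnormM. Qed.

Lemma nrm_cstarM a : nrm (a^* \* a) = nrm a ^+ 2.
Proof.
by have := cnorm_star a; rewrite !nrmE -rmorphXn => -[].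
Qed.

Lemma nrm_cstar a : nrm a^* = nrm a.
Proof.
suff H b : nrm b <= nrm b^*.
  by apply/eqP; rewrite eq_le H andbT -{2}(cstarK a) H.
have [b0|b0] := eqVneq (nrm b) 0; first by rewrite b0 nrm_ge0.
have bp : 0 < nrm b by rewrite lt_def b0 nrm_ge0.
by rewrite -(ler_pM2r bp) -expr2 -nrm_cstarM nrmM.
Qed.

Lemma nrm_Mcstar a : nrm (a \* a^*) = nrm a ^+ 2.
Proof. by rewrite -{1}(cstarK a) nrm_cstarM nrm_cstar. Qed.

Lemma cstarM_eq0 a : a^* \* a = 0 -> a = 0.
Proof.
move=> a0; apply: nrm_eq0; apply/eqP.
by rewrite -sqrf_eq0 -nrm_cstarM a0 nrm0.
Qed.

Lemma nrm_eq_cstarM a b : a^* \* a = b^* \* b -> nrm a = nrm b.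
Proof.
by move=> ab; apply/eqP; rewrite -(@eqrXn2 _ 2) ?nrm_ge0// -!nrm_cstarM ab.
Qed.

Lemma lip_cmull b : lip (fun a => cmul a b).
Proof.
apply: (lip_linear (cmul_linl b) (nrm_ge0 b)) => a.
by rewrite mulrC nrmM.
Qed.

Lemma lip_cmulr a : lip (fun b => cmul a b).
Proof. by apply: (lip_linear (cmul_linr a) (nrm_ge0 a)) => b; exact: nrmM. Qed.

Lemma lip_cstar : lip (@cstar R A).
Proof. by exists 1 => // a b; rewrite mul1r -cstarB nrm_cstar. Qed.

(* Formally [x b + e (b - z b) = (x + e (1 - z)) b], where [x + e (1 - z)] is
   unitary. *)
Lemma unitary_cstarM (x z b : A) (e : R[i]) :
  x^* = x -> z^* = z -> x \* z = z \* x -> x \* x = z + z - z \* z ->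
  Num.conj e = - e -> e * e = -1 ->
  let w := x \* b + e *: (b - z \* b) in w^* \* w = b^* \* b.
Proof.
move=> xs zs xz xx es ee /=; set d := x \* b; set c := b - z \* b.
have dc : d^* \* c = c^* \* d.
  rewrite /d /c cstarB !cstarM xs zs cmulBr cmulBl -!cmulA; congr (_ - _).
  by rewrite !(cmulA _ _ b) xz.
have dd : d^* \* d + c^* \* c = b^* \* b.
  rewrite /d /c cstarB !cstarM xs zs cmulBr !cmulBl -!cmulA (cmulA x).
  rewrite xx !cmulBl !cmulDl !cmulBr !cmulDr -!cmulA.
  set p := b^* \* (z \* b); set q := b^* \* (z \* (z \* b)).
  rewrite opprB addrACA addKr -addrA -[_ - p - p]addrA -opprD.
  by rewrite addrC subrK.
rewrite cstarD cstarZ es cmulDl !cmulDr !cmulZr !cmulZl dc !scaleNr.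
by rewrite scalerN scalerA ee scaleN1r opprK -dd addrA addrK.
Qed.

(** [x] is the mean of the unitaries [x + i (1 - z)] and [x - i (1 - z)], each of which preserves
    the norm of [b]. *)
Lemma nrm_sqrt_mul (x z b : A) :
  x^* = x -> z^* = z -> x \* z = z \* x -> x \* x = z + z - z \* z ->
  nrm (x \* b) <= nrm b.
Proof.
move=> xs zs xz xx.
pose w e := x \* b + e *: (b - z \* b).
have nw e : Num.conj e = - e -> e * e = -1 -> nrm (w e) = nrm b.
  by move=> es ee; apply: nrm_eq_cstarM; exact: unitary_cstarM.
have ii : 'i * 'i = -1 :> R[i] by rewrite -expr2 sqrCi.
have H : x \* b + x \* b = w 'i + w (- 'i).
  by rewrite /w addrACA scaleNr subrr addr0.
rewrite -(ler_pMn2r (ltn0Sn 1)).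
have ni : nrm (w (- 'i)) = nrm b.
  by apply: nw; rewrite ?mulrNN// rmorphN/= conjCi.
by rewrite -nrm_double H mulr2n -{1}(nw 'i (conjCi _) ii) -ni nrmD.
Qed.

(** Taking [b = x] in [nrm_sqrt_mul] gives [|x|^2 = |x x| <= |x|]. *)
Lemma nrm_sqrt_le1 (x z : A) :
  x^* = x -> z^* = z -> x \* z = z \* x -> x \* x = z + z - z \* z ->
  nrm x <= 1.
Proof.
move=> xs zs xz xx; have := nrm_sqrt_mul x xs zs xz xx.
rewrite -{1}xs nrm_cstarM expr2 => H.
have [x0|x0] := eqVneq (nrm x) 0; first by rewrite x0.
have xp : 0 < nrm x by rewrite lt_def x0 nrm_ge0.
by rewrite -(ler_pM2r xp) mul1r.
Qed.

End CStarArithmetic.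

(** * Square roots and *-homomorphisms *)

Section SquareRoot.
Context {R : realType}.

(* The iteration [y |-> (r + y^2) / 2] for [1 - sqrt (1 - r)]; the scalar
   iteration with [r = 1] dominates the one with [r] in the unit ball. *)
Fixpoint sqrt_iter_scalar (n : nat) : R :=
  if n is m.+1 then (1 + sqrt_iter_scalar m ^+ 2) / 2 else 0.

Fixpoint sqrt_iter (A : cstarType R) (w : A) (n : nat) : A :=
  if n is m.+1 then (2^-1)%:C%C *: (w + sqrt_iter w m \* sqrt_iter w m) else 0.

Local Notation s := sqrt_iter_scalar.

Lemma sqrt_iter_scalar_bounds n : 0 <= s n <= 1.
Proof.
elim: n => [|n /andP[s0 s1]] /=; first by rewrite lexx ler01.
have : s n ^+ 2 <= 1 by rewrite expr_le1.
have := sqr_ge0 (s n); lra.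
Qed.

(** Any [N] with [s N] within [e] of the supremum works, since no [s n] exceeds the supremum. *)
Lemma sqrt_iter_scalar_cauchy (e : R) : 0 < e ->
  exists N, forall n, (N <= n)%N -> s n - s N < e.
Proof.
move=> e0; have hs : has_sup (range s).
  split; first by exists (s 0%N); exists 0%N.
  by exists 1 => _ [n _ <-]; have /andP[] := sqrt_iter_scalar_bounds n.
have [_ [N _ <-] HN] := sup_adherent e0 hs.
exists N => n _; rewrite ltrBlDr -ltrBlDl; apply: le_lt_trans HN.
by rewrite lerD2r; apply: sup_upper_bound => //; exists n.
Qed.

Context {A : cstarType R} {w : A}.
Hypotheses (ws : w^* = w) (w1 : nrm w <= 1).
Local Notation z := (sqrt_iter w).

Lemma sqrt_iter_star n : (z n)^* = z n.
Proof.
elim: n => [|n IH] /=; first by rewrite cstar0.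
by rewrite cstarZr cstarD cstarM IH ws.
Qed.

Lemma sqrt_iter_comm c n : c \* w = w \* c -> c \* z n = z n \* c.
Proof.
move=> cw; elim: n => [|n IH] /=; first by rewrite cmulx0 cmul0x.
by rewrite cmulZl cmulZr cmulDl cmulDr cw cmulA IH -cmulA IH cmulA.
Qed.

Let half0 : 0 <= 2^-1 :> R. Proof. by rewrite invr_ge0. Qed.

Lemma sqrt_iter_bound n : nrm (z n) <= s n.
Proof.
elim: n => [|n IH] /=; first by rewrite nrm0.
rewrite nrmZr// mulrC ler_wpM2r//; apply: le_trans (nrmD _ _) _.
apply: lerD => //; apply: le_trans (nrmM _ _) _.
by rewrite expr2 ler_pM// nrm_ge0.
Qed.

Lemma cmul_sub_squares (x y : A) : x \* y = y \* x ->
  x \* x - y \* y = (x - y) \* (x + y).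
Proof.
by move=> xy; rewrite cmulBl !cmulDr xy opprD addrA addrK.
Qed.

(** The iterates commute, so consecutive differences satisfy [d_(n+1) = d_n (z_(n+1) + z_n) / 2];
    the scalar iteration obeys the same recursion and dominates it term by term. *)
Lemma sqrt_iter_step n : nrm (z n.+1 - z n) <= s n.+1 - s n.
Proof.
elim: n => [|n IH].
  rewrite /= !subr0 cmul0x addr0 expr0n addr0 nrmZr// mul1r.
  by rewrite -[leRHS]mulr1 ler_wpM2l.
have zz : z n.+1 \* z n = z n \* z n.+1.
  by apply/sqrt_iter_comm/esym/sqrt_iter_comm.
have -> : z n.+2 - z n.+1 =
    (2^-1)%:C%C *: ((z n.+1 - z n) \* (z n.+1 + z n)).
  have zS m : z m.+1 = (2^-1)%:C%C *: (w + z m \* z m) by [].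
  rewrite -cmul_sub_squares// (zS n.+1) {2}zS -scalerBr.
  by congr (_ *: _); rewrite opprD addrACA subrr add0r.
have -> : s n.+2 - s n.+1 = 2^-1 * ((s n.+1 - s n) * (s n.+1 + s n)).
  by rewrite /=; field.
rewrite nrmZr// ler_wpM2l//; apply: le_trans (nrmM _ _) _.
rewrite ler_pM ?nrm_ge0//; apply: le_trans (nrmD _ _) _.
by apply: lerD; exact: sqrt_iter_bound.
Qed.

Lemma sqrt_iter_dist m n : (m <= n)%N -> nrm (z n - z m) <= s n - s m.
Proof.
elim: n => [|n IH]; first by rewrite leqn0 => /eqP ->; rewrite !subrr nrm0.
rewrite leq_eqVlt ltnS => /predU1P[->|/IH {}IH]; first by rewrite !subrr nrm0.
apply: le_trans (nrm_dist (z n) _ _) _.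
by have := lerD (sqrt_iter_step n) IH; rewrite addrA subrK.
Qed.

(** The third clause is the fixed-point equation of the iteration, that is [(1 - z)^2 = 1 - w]. The
    last clause stands in for functional calculus: [z] commutes with whatever commutes with [w]. *)
Lemma cstar_sqrt : exists z : A,
  [/\ z^* = z, nrm z <= 1, z + z - z \* z = w &
      forall c, c \* w = w \* c -> c \* z = z \* c].
Proof.
have [|l lP] := complete_nrm (u := z).
  move=> e e0; have [N HN] := sqrt_iter_scalar_cauchy (divr_gt0 e0 (ltr0n _ 2)).
  exists N => m n Nm Nn; apply: le_lt_trans (nrm_dist (z N) _ _) _.
  rewrite (splitr e) ltrD//.
    exact: le_lt_trans (sqrt_iter_dist Nm) (HN _ Nm).
  by rewrite nrmBC; exact: le_lt_trans (sqrt_iter_dist Nn) (HN _ Nn).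
have cl (S : set A) : closed S -> (forall n, S (z n)) -> S l.
  move=> /closedP cS Sz; apply: cS => e /lP[N HN].
  by exists (z N) => //; rewrite nrmBC; exact: HN.
have l1 : nrm l <= 1.
  apply/ler_addgt0Pl => e /lP[N HN].
  have := lerD (ltW (HN _ (leqnn N))) (sqrt_iter_bound N).
  have /andP[_ s1] := sqrt_iter_scalar_bounds N.
  have := nrm_dist (z N) l 0; rewrite !subr0 nrmBC; lra.
exists l; split => //.
- apply: (cl [set a | a^* = a]) sqrt_iter_star.
  by apply: closed_eq_lip; [exact: lip_cstar|exact: lip_id].
- apply/eqP; rewrite -subr_eq0; apply/eqP/nrm_small => e e0.
  (* Substituting [w = 2 z_(N+1) - z_N^2] leaves four terms, each bounded by the distance of an
     iterate from [l]; hence [e / 4]. *)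
  have [N HN] := lP (e / 4) (divr_gt0 e0 (ltr0n _ 4)).
  have := HN _ (leqnn N); have := HN _ (leqnSn N).
  have zE : z N.+1 + z N.+1 = w + z N \* z N.
    rewrite /= -scalerDl -rmorphD /=.
    have -> : 2^-1 + 2^-1 = 1 :> R by field.
    by rewrite scale1r.
  have -> : l + l - l \* l - w = (l - z N.+1) + (l - z N.+1) +
      ((z N - l) \* z N + l \* (z N - l)).
    rewrite cmulBl cmulBr [_ + (_ - l \* l)]addrA subrK.
    rewrite [l - _ + _]addrACA -opprD zE.
    by rewrite opprD !addrA subrK addrAC.
  rewrite nrmBC => H1 H2.
  apply: le_trans (nrmD _ _) _; rewrite nrm_double.
  have := nrmD ((z N - l) \* z N) (l \* (z N - l)).
  have := nrmM (z N - l) (z N); have := nrmM l (z N - l).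
  have /andP[_ s1] := sqrt_iter_scalar_bounds N.
  have z1 := le_trans (sqrt_iter_bound N) s1.
  have := ler_wpM2l (nrm_ge0 (z N - l)) z1.
  have := ler_wpM2r (nrm_ge0 (z N - l)) l1.
  by rewrite mulr1 mul1r; lra.
- move=> c cw; apply: (cl [set a | c \* a = a \* c]) => [|n].
    by apply: closed_eq_lip; [exact: lip_cmulr|exact: lip_cmull].
  exact: sqrt_iter_comm.
Qed.

End SquareRoot.

Section StarHomomorphisms.
Context {R : realType} {A B : cstarType R} {phi : A -> B}.
Hypothesis phiH : star_hom phi.

Lemma hom_lin : linear phi. Proof. by case: phiH. Qed.
Lemma homM a b : phi (a \* b) = phi a \* phi b. Proof. by case: phiH. Qed.
Lemma hom_star a : phi a^* = (phi a)^*. Proof. by case: phiH. Qed.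

Lemma nrm_normalize (h : A) : h != 0 -> nrm ((nrm h)^-1%:C%C *: h) = 1.
Proof.
move=> h0; rewrite nrmZr ?invr_ge0 ?nrm_ge0// mulVf//.
by apply: contraNneq h0 => /nrm_eq0 ->.
Qed.

(** For selfadjoint [h] in the unit ball, [h^2 = 2 z - z^2] for some [z]. This relation survives
    under [phi] and puts [phi h] in the unit ball. The general case follows by rescaling and passing
    to [a^* a]. *)
Lemma hom_contractive a : nrm (phi a) <= nrm a.
Proof.
have sa1 (h : A) : h^* = h -> nrm h <= 1 -> nrm (phi h) <= 1.
  move=> hs h1; have [||z [zs _ zE zc]] := @cstar_sqrt R A (h \* h).
  - by rewrite cstarM hs.
  - by apply: le_trans (nrmM _ _) _; rewrite mulr_ile1// nrm_ge0.
  apply: (@nrm_sqrt_le1 _ _ _ (phi z)).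
  - by rewrite -hom_star hs.
  - by rewrite -hom_star zs.
  - by rewrite -!homM zc// cmulA.
  - by rewrite -!homM -(linD hom_lin) -(linB hom_lin) zE.
have sa (h : A) : h^* = h -> nrm (phi h) <= nrm h.
  move=> hs; have [->|h0] := eqVneq h 0; first by rewrite (lin0 hom_lin) !nrm0.
  have n0 : 0 < nrm h.
    by rewrite lt_def nrm_ge0 andbT; apply: contraNneq h0 => /nrm_eq0 ->.
  have := sa1 ((nrm h)^-1%:C%C *: h); rewrite cstarZr hs => /(_ erefl).
  rewrite nrm_normalize// => /(_ (lexx _)).
  rewrite (linZ hom_lin) nrmZr ?invr_ge0 ?nrm_ge0// mulrC.
  by rewrite ler_pdivrMr// mul1r.
rewrite -(@ler_pXn2r _ 2) ?nnegrE ?nrm_ge0// -!nrm_cstarM -hom_star -homM.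
by apply: sa; rewrite cstarM cstarK.
Qed.

Lemma lip_hom : lip phi.
Proof.
by apply: (lip_linear hom_lin ler01) => a; rewrite mul1r hom_contractive.
Qed.

(** The difference [d = x - y] satisfies [2 d = d (x + y)] with [|x + y| < 2]. *)
Lemma sqrt_unique (x y : B) : x \* y = y \* x ->
  x + x - x \* x = y + y - y \* y -> nrm x <= 1 -> nrm y < 1 -> x = y.
Proof.
move=> xy E x1 y1; apply/eqP; rewrite -subr_eq0; apply/eqP/nrm_eq0.
have dd : (x - y) + (x - y) = (x - y) \* (x + y).
  rewrite -cmul_sub_squares// addrACA -opprD.
  by rewrite (canRL (subrK _) E) -[_ - _ + _]addrA addrC addKr addrC.
have := nrmM (x - y) (x + y); rewrite -dd nrm_double.
have := ler_wpM2l (nrm_ge0 (x - y)) (le_trans (nrmD x y) (lerD x1 (lexx _))).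
have := nrm_ge0 (x - y); set d := nrm (x - y) => d0 H1 H2.
apply/eqP; rewrite eq_le d0 andbT leNgt; apply/negP => dp.
have : d * (1 - nrm y) <= 0 by lra.
by rewrite pmulr_rle0//; lra.
Qed.

Hypothesis phi0 : forall a, phi a = 0 -> a = 0.

(* If [|phi x| < 1 < |x| <= 2] for [x = g^2] then [x - (1 - |1 - x|)] is a
   nonzero element in the kernel, where [|1 - x|] is the square root of
   [(1 - x)^2]. *)
Lemma hom_injective_sq (g : A) : g^* = g -> 1 < nrm (g \* g) ->
  nrm (g \* g) <= 2 -> nrm (phi (g \* g)) < 1 -> False.
Proof.
set x := g \* g => gs x1 x2 px1.
have xs : x^* = x by rewrite cstarM gs.
have h0 : 0 <= 2^-1 :> R by rewrite invr_ge0.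
(* The bound 2 on [|x|] allows [(1 - z)^2 = 1 - x / 2], so that [a = sqrt 2 g (1 - z)] is a
   selfadjoint square root of [2 x - x^2 = 1 - (1 - x)^2]. *)
have [||z [zs _ zE zc]] := @cstar_sqrt R A (2^-1%:C%C *: x).
- by rewrite cstarZr xs.
- by rewrite nrmZr// mulrC ler_pdivrMr// mul1r.
have gx : g \* x = x \* g by rewrite cmulA.
have gz : g \* z = z \* g by apply: zc; rewrite cmulZl cmulZr gx.
have xz : x \* z = z \* x by rewrite -cmulA gz cmulA gz cmulA.
pose a := (Num.sqrt 2)%:C%C *: (g - g \* z).
have as_ : a^* = a by rewrite cstarZr cstarB cstarM gs zs -gz.
have aa : a \* a = x + x - x \* x.
  rewrite cmulZl cmulZr scalerA -rmorphM /= -expr2 sqr_sqrtr//.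
  have -> : (g - g \* z) \* (g - g \* z) = x - x \* (z + z - z \* z).
    have e1 : (g \* z) \* g = x \* z by rewrite -cmulA -gz cmulA.
    rewrite cmulBl !cmulBr -/x cmulDr cmulA -/x e1 cmulA e1 -cmulA.
    by rewrite -addrA -opprD addrA.
  rewrite zE cmulZr scalerBr scalerA -rmorphM/= mulfV// scale1r.
  by rewrite rmorph_nat scaler_nat mulr2n.
have ax : a \* x = x \* a.
  by rewrite cmulZl cmulZr cmulBl cmulBr gx -cmulA -xz cmulA gx -cmulA.
have a1 : nrm a <= 1 by apply: (@nrm_sqrt_le1 _ _ _ x).
(* This [y] is [1 - |1 - x|]. It has norm at most 1, so it differs from [x], whereas [phi y = phi x]
   by uniqueness of the root. *)
have [||y [ys y1 yE yc]] := @cstar_sqrt R A (a \* a).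
- by rewrite cstarM as_.
- by apply: le_trans (nrmM _ _) _; rewrite mulr_ile1// nrm_ge0.
have xy : x \* y = y \* x by apply: yc; rewrite cmulA -ax -cmulA -ax cmulA.
suff /eqP : y - x = 0.
  by rewrite subr_eq0 => /eqP yx; move: x1; rewrite -yx ltNge y1.
apply: phi0; rewrite (linB hom_lin); apply/eqP; rewrite subr_eq0; apply/eqP.
apply: sqrt_unique => //.
- by rewrite -!homM xy.
- by rewrite -!homM -!(linD hom_lin) -!(linB hom_lin) yE aa.
- exact: le_trans (hom_contractive _) y1.
Qed.

Lemma hom_isometric a : nrm (phi a) = nrm a.
Proof.
apply/eqP; rewrite eq_le hom_contractive /= leNgt; apply/negP => lt_a.
pose h := a^* \* a; have hs : h^* = h by rewrite cstarM cstarK.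
have ph : nrm (phi h) = nrm (phi a) ^+ 2 by rewrite homM hom_star nrm_cstarM.
have nh : nrm h = nrm a ^+ 2 by exact: nrm_cstarM.
have phh : nrm (phi (h \* h)) = nrm (phi h) ^+ 2.
  by rewrite -{1}hs homM hom_star nrm_cstarM.
have nhh : nrm (h \* h) = nrm h ^+ 2 by rewrite -{1}hs nrm_cstarM.
have lt_h : nrm (phi h) < nrm h by rewrite ph nh ltr_pXn2r ?nnegrE ?nrm_ge0.
have n0 : 0 < nrm h := le_lt_trans (nrm_ge0 _) lt_h.
pose q := nrm (phi h) / nrm h.
have q0 : 0 <= q by rewrite divr_ge0 ?nrm_ge0.
have q1 : q < 1 by rewrite ltr_pdivrMr// mul1r.
(* After scaling, [t h] has norm [1 / r] and its image has norm [q / r]. So [r] must lie strictly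
   between [q] and 1, and [r >= 3/4] ensures [1 / r^2 <= 16/9 <= 2]. *)
pose r := Num.max ((1 + q) / 2) (3 / 4).
have r1 : r < 1 by rewrite gt_max; apply/andP; split; lra.
have r34 : 3 / 4 <= r by rewrite le_max lexx orbT.
have qr : q < r by rewrite lt_max; apply/orP; left; lra.
have r0 : 0 < r by lra.
pose t := (r * nrm h)^-1.
have t0 : 0 < t by rewrite invr_gt0 mulr_gt0.
have tn : t * nrm h = r^-1 by rewrite /t; field; rewrite ?gt_eqF.
have tp : t * nrm (phi h) = q / r by rewrite /t /q; field; rewrite ?gt_eqF.
have E : (t%:C%C *: h) \* (t%:C%C *: h) = (t ^+ 2)%:C%C *: (h \* h).
  by rewrite cmulZl cmulZr scalerA -rmorphM.
apply: (@hom_injective_sq (t%:C%C *: h)).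
- by rewrite cstarZr hs.
- rewrite E nrmZr ?sqr_ge0// nhh -exprMn tn expr_gt1// ?invr_ge0 ?(ltW r0)//.
  by rewrite invf_gt1.
- rewrite E nrmZr ?sqr_ge0// nhh -exprMn tn exprVn.
  rewrite -[leLHS]mul1r ler_pdivrMr ?exprn_gt0//.
  have : (3 / 4) ^+ 2 <= r ^+ 2 by rewrite ler_pXn2r ?nnegrE ?(ltW r0).
  by rewrite expr2; lra.
- rewrite E (linZ hom_lin) nrmZr ?sqr_ge0// phh -exprMn tp.
  have qr0 : 0 <= q / r by rewrite mulr_ge0// invr_ge0 ltW.
  by rewrite expr_lt1// ltr_pdivrMr// mul1r.
Qed.

Lemma closed_star_subalgebra_range : closed_star_subalgebra (range phi).
Proof.
split; first split.
- exact: closed_range_isometry hom_lin hom_isometric.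
- by exists 0 => //; exact: (lin0 hom_lin).
- by move=> k _ _ [a _ <-] [b _ <-]; exists (k *: a + b) => //; exact: hom_lin.
- by move=> _ _ [a _ <-] [b _ <-]; exists (a \* b) => //; exact: homM.
- by move=> _ [a _ <-]; exists a^* => //; exact: hom_star.
Qed.

Lemma hom_bijective (S : set B) :
  closed_span_full S -> S `<=` range phi -> bijective phi.
Proof.
move=> Sfull Sphi.
have phi_inj : injective phi.
  move=> a b ab; apply/eqP; rewrite -subr_eq0; apply/eqP/phi0.
  by rewrite (linB hom_lin) ab subrr.
have [rS _ _] := closed_star_subalgebra_range.
have rT : range phi = setT := Sfull _ rS Sphi.
have /choice[f fK] (b : B) : exists a, phi a = b.
  by have : range phi b by [rewrite rT]; case=> a _ <-; exists a.
by exists f => // a; apply: phi_inj.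
Qed.

End StarHomomorphisms.

(** * Closed spans and multipliers *)

Section ClosedSubspaces.
Context {R : realType}.
Implicit Types A B : cstarType R.

Lemma closed_subspace_preimage A B (f : A -> B) (W : set B) :
  linear f -> lip f -> closed_subspace W -> closed_subspace [set x | W (f x)].
Proof.
move=> fL fl [cW W0 WD]; split; first exact: closed_preimage_lip.
  by rewrite /= (lin0 fL).
by move=> k a b /= Wa Wb; rewrite fL; exact: WD.
Qed.

Lemma closed_subspace_eq A B (f g : A -> B) :
  linear f -> lip f -> linear g -> lip g -> closed_subspace [set x | f x = g x].
Proof.
move=> fL fl gL gl; split; first exact: closed_eq_lip.
  by rewrite /= (lin0 fL) (lin0 gL).
by move=> k a b /= Ea Eb; rewrite fL gL Ea Eb.
Qed.

Lemma closed_subspace_star A (W : set A) :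
  closed_subspace W -> closed_subspace [set x | W x^*].
Proof.
move=> [cW W0 WD]; split.
- exact: closed_preimage_lip lip_cstar cW.
- by rewrite /= cstar0.
- by move=> k a b /= Wa Wb; rewrite cstarD cstarZ; exact: WD.
Qed.

Lemma closed_subspace_forall A (I : Type) (W : I -> set A) :
  (forall i, closed_subspace (W i)) ->
  closed_subspace [set x | forall i, W i x].
Proof.
move=> H; split.
- apply/closedP => a Ha i; have [/closedP cW _ _] := H i.
  by apply: cW => e /Ha[b Wb ab]; exists b.
- by move=> i; have [] := H i.
- by move=> k a b Wa Wb i; have [_ _ WD] := H i; exact: WD.
Qed.

Lemma closed_subspaceI A (V W : set A) :
  closed_subspace V -> closed_subspace W -> closed_subspace (V `&` W).
Proof.
move=> [cV V0 VD] [cW W0 WD]; split; first exact: closedI.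
  by [].
by move=> k a b [Va Wa] [Vb Wb]; split; [exact: VD|exact: WD].
Qed.

Lemma closed_span_full_ind A (S W : set A) :
  closed_span_full S -> closed_subspace W -> S `<=` W -> forall x, W x.
Proof. by move=> Sf /Sf H /H -> x. Qed.

Lemma generates_ind A (S W : set A) :
  cstar_generates S -> closed_star_subalgebra W -> S `<=` W -> forall x, W x.
Proof. by move=> Sf /Sf H /H -> x. Qed.

Definition closed_span A (S : set A) : set A :=
  [set x | forall W, closed_subspace W -> S `<=` W -> W x].

Lemma closed_span_subspace A (S : set A) : closed_subspace (closed_span S).
Proof.
split.
- apply/closedP => a Ha W Wsub SW; have [/closedP cW _ _] := Wsub.
  by apply: cW => e /Ha[b Sb ab]; exists b => //; exact: Sb.
- by move=> W [].
- move=> k a b Sa Sb W Wsub SW; have [_ _ WD] := Wsub.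
  by apply: WD; [exact: Sa|exact: Sb].
Qed.

Lemma sub_closed_span A (S : set A) : S `<=` closed_span S.
Proof. by move=> x Sx W _; exact. Qed.

Lemma closed_span_star_subalgebra A (S : set A) :
  (forall x y, S x -> S y -> closed_span S (x \* y)) ->
  (forall x, S x -> closed_span S x^*) ->
  closed_star_subalgebra (closed_span S).
Proof.
move=> SM SS; have cS := closed_span_subspace S; split=> //.
- move=> a b Sa Sb.
  apply: (Sb [set b | closed_span S (a \* b)]) => [|y Sy].
    exact: closed_subspace_preimage (cmul_linr a) (lip_cmulr a) cS.
  apply: (Sa [set a | closed_span S (a \* y)]) => [|x Sx]; last exact: SM.
  exact: closed_subspace_preimage (cmul_linl y) (lip_cmull y) cS.
- by move=> a /(_ [set a | closed_span S a^*]); apply=> //;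
    exact: closed_subspace_star.
Qed.

End ClosedSubspaces.

Lemma cmul_sum {R : realType} {A : cstarType R} (I J : Type) (l : seq I)
    (m : seq J) (f : I -> A) (g : J -> A) :
  (\sum_(i <- l) f i) \* (\sum_(j <- m) g j) =
  \sum_(i <- l) \sum_(j <- m) f i \* g j.
Proof.
rewrite (lin_sum (cmul_linl _)); apply: eq_bigr => i _.
by rewrite (lin_sum (cmul_linr _)).
Qed.

Lemma cstar_sum {R : realType} {A : cstarType R} (I : Type) (l : seq I)
    (f : I -> A) : (\sum_(i <- l) f i)^* = \sum_(i <- l) (f i)^*.
Proof.
by elim: l => [|i l IH]; rewrite ?big_nil ?cstar0// !big_cons cstarD IH.
Qed.

(** * Extending a map that preserves the products [x_i^* x_j] *)

Section IsometryExtension.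
Context {R : realType} {A : cstarType R} {I : Type} {x y : I -> A}.
Hypothesis x_full : closed_span_full (range x).
Hypothesis xy : forall i j, (y i)^* \* y j = (x i)^* \* x j.

Let comb (z : I -> A) (l : seq (R[i] * I)) : A :=
  \sum_(p <- l) p.1 *: z p.2.

Let comb_cstarM l m :
  (comb y l)^* \* comb y m = (comb x l)^* \* comb x m.
Proof.
rewrite !cstar_sum !cmul_sum; apply: eq_bigr => p _; apply: eq_bigr => q _.
by rewrite !cstarZ !cmulZl !cmulZr xy.
Qed.

Let comb_lin z k l m :
  comb z ([seq (k * p.1, p.2) | p <- l] ++ m) = k *: comb z l + comb z m.
Proof.
rewrite /comb big_cat big_map scaler_sumr; congr (_ + _).
by apply: eq_bigr => p _; rewrite scalerA.
Qed.

Let nrm_comb l : nrm (comb y l) = nrm (comb x l).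
Proof. by apply: nrm_eq_cstarM; exact: comb_cstarM. Qed.

Let nrm_combB l m :
  nrm (comb y l - comb y m) = nrm (comb x l - comb x m).
Proof.
have E z : comb z l - comb z m = comb z ([seq (-1 * p.1, p.2) | p <- m] ++ l).
  by rewrite comb_lin scaleN1r addrC.
by rewrite !E nrm_comb.
Qed.

(** The closed graph of the extension. It is a relation because an element does not determine the
    coefficients of the combinations approaching it. *)
Let approx a b := forall e : R, 0 < e ->
  exists l, nrm (a - comb x l) < e /\ nrm (b - comb y l) < e.

Let approx_lin k a b a' b' :
  approx a b -> approx a' b' -> approx (k *: a + a') (k *: b + b').
Proof.
move=> H H' e e0; pose C := complex.Re `|k| + 1.
have C1 : 1 <= C.
  by rewrite /C lerDr Re_normc_ge0.
have C0 : 0 < C by lra.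
have [l [l1 l2]] := H (e / 2 / C) (divr_gt0 (divr_gt0 e0 (ltr0n _ 2)) C0).
have [l' [l1' l2']] := H' (e / 2) (divr_gt0 e0 (ltr0n _ 2)).
exists ([seq (k * p.1, p.2) | p <- l] ++ l').
suff est (z : I -> A) c c' : nrm (c - comb z l) < e / 2 / C ->
    nrm (c' - comb z l') < e / 2 -> nrm (k *: c + c' -
      comb z ([seq (k * p.1, p.2) | p <- l] ++ l')) < e.
  by split; apply: est.
move=> h h'; rewrite comb_lin opprD addrACA -scalerBr (splitr e).
apply: le_lt_trans (nrmD _ _) _; rewrite ltr_leD// 1?ltW// nrmZ.
move: h; rewrite ltr_pdivlMr// mulrC; apply: le_lt_trans.
by rewrite ler_wpM2r ?nrm_ge0// /C lerDl.
Qed.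

(** Combinations of the [x i] that converge are Cauchy, and by [nrm_combB] so are the matching
    combinations of the [y i]; completeness then provides the partner. *)
Let approx_total a : exists b, approx a b.
Proof.
apply: (closed_span_full_ind x_full (W := [set a | exists b, approx a b])).
  split.
  - apply/closedP => c H.
    have /choice[u uP] (n : nat) : exists l, nrm (c - comb x l) < n.+1%:R^-1.
      have n0 : 0 < n.+1%:R^-1 / 2 :> R by rewrite divr_gt0// invr_gt0.
      have [d [b db] cd] := H _ n0; have [l [dl _]] := db _ n0.
      exists l; apply: le_lt_trans (nrm_dist d _ _) _.
      by rewrite (splitr n.+1%:R^-1) ltrD.
    have [|b bP] := complete_nrm (u := fun n => comb y (u n)).
      move=> e e0; have [N HN] := invS_small (divr_gt0 e0 (ltr0n _ 2)).
      exists N => m n Nm Nn; rewrite nrm_combB.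
      apply: le_lt_trans (nrm_dist c _ _) _; rewrite (splitr e) ltrD//.
        by rewrite nrmBC; apply: lt_trans (uP m) _; exact: HN.
      by apply: lt_trans (uP n) _; exact: HN.
    exists b => e e0; have [N1 H1] := invS_small e0; have [N2 H2] := bP e e0.
    exists (u (maxn N1 N2)); split; last by rewrite nrmBC H2// leq_maxr.
    by apply: lt_trans (uP _) _; rewrite H1// leq_maxl.
  - exists 0 => e e0; exists [::].
    by rewrite /comb !big_nil subrr nrm0.
  - by move=> k a' b' [c ac] [d bd]; exists (k *: c + d); exact: approx_lin.
move=> _ [i _ <-]; exists (y i) => e e0; exists [:: (1, i)].
by rewrite /comb !big_seq1 !scale1r !subrr nrm0.
Qed.

Let approx_nrm a b : approx a b -> nrm b <= nrm a.
Proof.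
move=> H; apply/ler_addgt0Pl => e e0.
have [l [al bl]] := H (e / 2) (divr_gt0 e0 (ltr0n _ 2)).
have := nrm_dist (comb y l) b 0; have := nrm_dist a (comb x l) 0.
by rewrite !subr0 (nrmBC (comb x l)) nrm_comb; lra.
Qed.

Let approx_uniq a b c : approx a b -> approx a c -> b = c.
Proof.
move=> ab ac; apply/eqP; rewrite -subr_eq0; apply/eqP/nrm_small => e e0.
have := approx_nrm (approx_lin (-1) ac ab).
rewrite !scaleN1r addNr nrm0 addrC => /le_trans; apply.
exact: ltW.
Qed.

(** Equal Gram matrices make [sum k_i x_i |-> sum k_i y_i] well defined and isometric; density does
    the rest. The product formula is extended in one factor, then in the other by adjoints. *)
Lemma extend_isometry : exists L : A -> A,
  [/\ linear L, forall a b, (L a)^* \* L b = a^* \* b &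
      forall i, L (x i) = y i].
Proof.
have [L LP] := choice approx_total; exists L.
have LL : linear L.
  by move=> k a b; apply: approx_uniq (LP _) _; exact: approx_lin.
have Ll : lip L.
  by apply: (lip_linear LL ler01) => a; rewrite mul1r approx_nrm.
have Lx i : L (x i) = y i.
  apply: approx_uniq (LP _) _ => e e0; exists [:: (1, i)].
  by rewrite /comb !big_seq1 !scale1r !subrr nrm0.
have comp_lin c : linear (fun b => c \* L b).
  by move=> k a b; rewrite LL (cmul_linr c).
have Lxb i b : (L (x i))^* \* L b = (x i)^* \* b.
  apply: (closed_span_full_ind x_full
    (W := [set b | (L (x i))^* \* L b = (x i)^* \* b])).
    apply: closed_subspace_eq (comp_lin _) _ (cmul_linr _) (lip_cmulr _).
    exact: lip_comp (lip_cmulr _) Ll.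
  by move=> _ [j _ <-] /=; rewrite !Lx xy.
split=> // a b.
apply: (closed_span_full_ind x_full
  (W := [set b | (L a)^* \* L b = a^* \* b])).
  apply: closed_subspace_eq (comp_lin _) _ (cmul_linr _) (lip_cmulr _).
  exact: lip_comp (lip_cmulr _) Ll.
move=> _ [j _ <-] /=; apply: (can_inj (@cstarK R A)).
by rewrite !cstarM !cstarK Lxb.
Qed.

End IsometryExtension.

Section UnitaryMultipliers.
Context {R : realType} {G : groupType} {A : cstarType R}.

(* [U t] is left multiplication by a unitary multiplier [u_t] of [A], where
   [t |-> u_t] is a homomorphism. *)
Definition unitary_rep (U : G -> A -> A) : Prop :=
  [/\ forall t, linear (U t),
      forall t a b, (U t a)^* \* U t b = a^* \* b,
      forall a, U 1%g a = a &
      forall s t a, U (s * t)%g a = U s (U t a)].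

Lemma unitary_rep_extend (I : Type) (x : I -> A) (act : G -> I -> I) :
  closed_span_full (range x) ->
  (forall t i j, (x (act t i))^* \* x (act t j) = (x i)^* \* x j) ->
  (forall i, x (act 1%g i) = x i) ->
  (forall s t i, x (act (s * t)%g i) = x (act s (act t i))) ->
  exists U, unitary_rep U /\ forall t i, U t (x i) = x (act t i).
Proof.
move=> xf xx x1 xM.
have /choice[U UP] (t : G) := extend_isometry xf (xx t).
have UL t : linear (U t) by have [] := UP t.
have UU t a b : (U t a)^* \* U t b = a^* \* b by have [] := UP t.
have Ux t i : U t (x i) = x (act t i) by have [] := UP t.
have Ul t : lip (U t).
  apply: (lip_linear (UL t) ler01) => a; rewrite mul1r.
  by rewrite (nrm_eq_cstarM (UU t a a)).
have idL : linear (@id A) by [].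
have UUL s t : linear (fun a => U s (U t a)) by move=> k a b; rewrite !UL.
exists U; split=> //; split=> // [a|s t a].
  apply: (closed_span_full_ind xf (W := [set a | U 1%g a = a])).
    exact: closed_subspace_eq (UL _) (Ul _) idL (lip_id _).
  by move=> _ [i _ <-] /=; rewrite Ux x1.
apply: (closed_span_full_ind xf (W := [set a | U (s * t)%g a = U s (U t a)])).
  exact: closed_subspace_eq (UL _) (Ul _) (UUL _ _) (lip_comp (Ul _) (Ul _)).
by move=> _ [i _ <-] /=; rewrite !Ux xM.
Qed.

(* Right multiplication by [u_t]. *)
Definition rmul (U : G -> A -> A) (t : G) (a : A) : A := (U t^-1%g a^*)^*.

Context {U : G -> A -> A} (UP : unitary_rep U).

Lemma lmul_lin t : linear (U t). Proof. by case: UP. Qed.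
Lemma lmul_cstarM t a b : (U t a)^* \* U t b = a^* \* b.
Proof. by case: UP. Qed.
Lemma lmul1 a : U 1%g a = a. Proof. by case: UP. Qed.
Lemma lmulM s t a : U (s * t)%g a = U s (U t a). Proof. by case: UP. Qed.

Lemma lmulVK t a : U t^-1%g (U t a) = a.
Proof. by rewrite -lmulM mulVg lmul1. Qed.

Lemma nrm_lmul t a : nrm (U t a) = nrm a.
Proof. exact/nrm_eq_cstarM/lmul_cstarM. Qed.

Lemma lip_lmul t : lip (U t).
Proof.
by apply: (lip_linear (lmul_lin t) ler01) => a; rewrite mul1r nrm_lmul.
Qed.

Lemma lmul_star t a : (U t a)^* = rmul U t^-1%g a^*.
Proof. by rewrite /rmul invgK cstarK. Qed.

Lemma rmul_star t a : (rmul U t a)^* = U t^-1%g a^*.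
Proof. exact: cstarK. Qed.

Lemma rmul_lin t : linear (rmul U t).
Proof.
by move=> k a b; rewrite /rmul cstarD cstarZ lmul_lin cstarD cstarZ conjCK.
Qed.

Lemma lip_rmul t : lip (rmul U t).
Proof. exact: lip_comp lip_cstar (lip_comp (lip_lmul _) lip_cstar). Qed.

Lemma rmul1 a : rmul U 1%g a = a.
Proof. by rewrite /rmul invg1 lmul1 cstarK. Qed.

Lemma rmulM s t a : rmul U t (rmul U s a) = rmul U (s * t)%g a.
Proof. by rewrite /rmul cstarK -lmulM invgM. Qed.

Lemma rmul_lmul t a b : rmul U t a \* b = a \* U t b.
Proof. by rewrite -{1}(lmulVK t b) lmul_cstarM cstarK. Qed.

(** [U t] is known only through products [x (U t y)], so the difference [d] of the two sides is
    shown to satisfy [x d = 0] for every [x], in particular for [x = d^*]. *)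
Lemma lmul_mul t a b : U t (a \* b) = U t a \* b.
Proof.
apply/eqP; rewrite -subr_eq0; apply/eqP/cstarM_eq0; set d := U t _ - _.
have dx x : x \* d = 0.
  rewrite /d cmulBr cmulA -!rmul_lmul cmulA.
  by rewrite subrr.
exact: dx.
Qed.

Lemma rmul_mul t a b : rmul U t (a \* b) = a \* rmul U t b.
Proof. by rewrite /rmul cstarM lmul_mul cstarM cstarK. Qed.

Lemma lmul_rmul s t a : U s (rmul U t a) = rmul U t (U s a).
Proof.
apply/eqP; rewrite -subr_eq0; apply/eqP/cstarM_eq0; set d := U s _ - _.
suff dx x : x \* d = 0 by exact: dx.
by rewrite /d cmulBr -rmul_lmul -!rmul_mul -rmul_lmul subrr.
Qed.

End UnitaryMultipliers.

(** * Systems of matrices over an algebra *)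

Section MatrixSystems.
Context {R : realType} {G : groupType} {A X : cstarType R}.

(* [m a r s] behaves like the matrix over [A] with the only nonzero entry [a]
   in position [(r, s)]. *)
Definition matrix_system (m : A -> G -> G -> X) : Prop :=
  [/\ forall r s, linear (fun a => m a r s),
      forall a b r s u v, m a r s \* m b u v =
        if s == u then m (a \* b) r v else 0 &
      forall a r s, (m a r s)^* = m a^* s r].

Definition matrix_entries (m : A -> G -> G -> X) : set X :=
  range (fun i : A * G * G => m i.1.1 i.1.2 i.2).

Context {m : A -> G -> G -> X} (mP : matrix_system m).

Lemma matrix_mul a b r s v : m a r s \* m b s v = m (a \* b) r v.
Proof. by case: mP => _ -> _; rewrite eqxx. Qed.

(** Translating the row index by [t^-1] is injective, so it leaves every [m(a,r,s)^* m(b,u,v)]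
    unchanged. *)
Lemma matrix_rep : closed_span_full (matrix_entries m) ->
  exists U, unitary_rep U /\
    forall t a r s, U t (m a r s) = m a (r * t^-1)%g s.
Proof.
move=> mf; have [_ mM mS] := mP.
pose act (t : G) (i : A * G * G) := (i.1.1, (i.1.2 * t^-1)%g, i.2).
have [|||U [UP Um]] := unitary_rep_extend (act := act) mf.
- move=> t [[a r] s] [[b u] v] /=; rewrite !mS !mM.
  by rewrite (inj_eq (mulIg _)).
- by move=> [[a r] s] /=; rewrite invg1 mulg1.
- by move=> s t [[a r] u] /=; rewrite invgM mulgA.
by exists U; split=> // t a r s; exact: (Um t (a, r, s)).
Qed.

Lemma matrix_diag_hom r : star_hom (fun a => m a r r).
Proof.
case: mP => mL _ mS; by split=> // a b; rewrite matrix_mul.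
Qed.

(** [|m a r s|^2] is the norm of the diagonal entry of [a a^*] at [r], and diagonal embeddings are
    contractive homomorphisms. *)
Lemma lip_matrix_entry r s : lip (fun a => m a r s).
Proof.
have [mL _ mS] := mP; apply: (lip_linear (mL r s) ler01) => a; rewrite mul1r.
rewrite -(@ler_pXn2r _ 2) ?nnegrE ?nrm_ge0// -nrm_Mcstar mS matrix_mul.
apply: le_trans (hom_contractive (matrix_diag_hom r) _) _.
by rewrite nrm_Mcstar.
Qed.

(* The corner [m A 1 1] is closed because injective *-homomorphisms are
   isometric, so [m a 1 r * d * m b s 1] lies in it for every [d]; these corner
   elements vanish if [phi d = 0]. *)
Lemma matrix_hom_injective (Y : cstarType R) (phi : X -> Y) :
  closed_span_full (matrix_entries m) -> star_hom phi ->
  (forall a, phi (m a 1%g 1%g) = 0 -> a = 0) ->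
  forall d, phi d = 0 -> d = 0.
Proof.
move=> mf phiH phi0 d pd; have [mL mM mS] := mP.
have phi00 := lin0 (hom_lin phiH).
have m0 a : m a 1%g 1%g = 0 -> a = 0 by move=> E; apply: phi0; rewrite E.
have [cM _ _] := closed_star_subalgebra_range (matrix_diag_hom 1%g) m0.
have corner a r b s e :
    range (fun a => m a 1%g 1%g) (m a 1%g r \* e \* m b s 1%g).
  apply: (closed_span_full_ind mf (W := [set e |
    range (fun a => m a 1%g 1%g) (m a 1%g r \* e \* m b s 1%g)])).
    apply: (closed_subspace_preimage
      (f := fun e => m a 1%g r \* e \* m b s 1%g)).
    - by move=> k x y; rewrite (cmul_linr _) (cmul_linl _).
    - exact: lip_comp (lip_cmull _) (lip_cmulr _).
    - exact: cM.
  move=> _ [[[c u] v] _ <-] /=; rewrite mM; case: eqP => _; last first.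
    by rewrite cmul0x; exists 0 => //; exact: (lin0 (mL _ _)).
  rewrite mM; case: eqP => _; last by exists 0 => //; exact: (lin0 (mL _ _)).
  by exists (a \* c \* b).
have mdm a r b s : m a 1%g r \* d \* m b s 1%g = 0.
  have [c _ cE] := corner a r b s d.
  rewrite -cE; have -> : c = 0; last exact: (lin0 (mL _ _)).
  by apply: phi0; rewrite cE !(homM phiH) pd cmulx0 cmul0x.
have dm b s : d \* m b s 1%g = 0.
  apply: cstarM_eq0; set w := d \* _.
  apply: (closed_span_full_ind mf (W := [set x | x \* w = 0])).
    apply: closed_subspace_eq (cmul_linl _) (lip_cmull _) _ (lip_cst _ 0).
    by move=> k x y; rewrite scaler0 addr0.
  (* Row [u] is traded for row 1: [m(a^* a, r, r) = m(a^*, r, 1) m(a, 1, r)], and the last factor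
     annihilates [w] by [mdm]. *)
  move=> _ [[[a u] r] _ <-] /=; apply: cstarM_eq0.
  rewrite cstarM mS -!cmulA (cmulA (m _ r u)) matrix_mul.
  rewrite -(matrix_mul _ _ r 1%g).
  by rewrite -!cmulA [m a _ _ \* w]cmulA mdm !cmulx0.
apply: (can_inj (@cstarK R X)); rewrite cstar0; apply: cstarM_eq0.
rewrite cstarK.
apply: (closed_span_full_ind mf (W := [set x | d \* x = 0])).
  apply: closed_subspace_eq (cmul_linr _) (lip_cmulr _) _ (lip_cst _ 0).
  by move=> k x y; rewrite scaler0 addr0.
move=> _ [[[b s] v] _ <-] /=; apply: (can_inj (@cstarK R X)).
rewrite cstar0; apply: cstarM_eq0; rewrite cstarK cstarM mS -cmulA.
rewrite (cmulA (m b s v)) matrix_mul -(matrix_mul _ _ s 1%g) !cmulA dm.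
by rewrite !cmul0x.
Qed.

End MatrixSystems.

(** * Compact operators on l2(G) *)

Section L2Coordinates.
Context {R : realType} {G : groupType}.
Implicit Types (x y : l2 R G) (r s g : G) (F : seq G).

Lemma l2_lin (k : R[i]) x y g : sval (k *: x + y) g = k * sval x g + sval y g.
Proof. by []. Qed.

Lemma l2_scale (k : R[i]) x g : sval (k *: x) g = k * sval x g.
Proof. by []. Qed.

Lemma l2_sub x y g : sval (x - y) g = sval x g - sval y g.
Proof. by []. Qed.

Lemma l2_eq x y : (forall g, sval x g = sval y g) -> x = y.
Proof. by move=> xy; apply/val_inj/funext. Qed.

Lemma sqmod0 : sqmod (0 : R[i]) = 0.
Proof. by rewrite /sqmod /= expr0n /= addr0. Qed.

Lemma sqsum_le (u v : G -> R[i]) :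
  (forall g, sqmod (u g) <= sqmod (v g)) -> (sqsum u <= sqsum v)%E.
Proof. by move=> uv; apply: le_esum => g _; rewrite lee_fin. Qed.

Lemma nrm_l2_le x y :
  (forall g, sqmod (sval x g) <= sqmod (sval y g)) -> nrm x <= nrm y.
Proof.
move=> /sqsum_le; rewrite -![sqsum (sval _)]/(sqsum (\val _)) !l2normrE lee_fin.
by rewrite ler_pXn2r// nnegrE l2normr_ge0.
Qed.

Lemma sqsummable_finite_support F (u : G -> R[i]) :
  (forall g, g \notin F -> u g = 0) -> sqsummable u.
Proof.
move=> u0; rewrite /sqsummable /sqsum (esumID [set` F])/=; last first.
  by move=> g _; rewrite lee_fin sqmod_ge0.
rewrite [X in (_ + X)%E]esum1 ?adde0; last first.
  by move=> g [_ /= /negP gF]; rewrite u0// sqmod0.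
rewrite setTI esum_fset//; last first.
- by move=> g _; rewrite lee_fin sqmod_ge0.
- exact: finite_seq.
by rewrite fsbig_finite ?sumEFin ?ltry//; exact: finite_seq.
Qed.

Definition restrict F (u : G -> R[i]) (g : G) : R[i] :=
  if g \in F then u g else 0.

Lemma restrict_sqsummable F u : sqsummable (restrict F u).
Proof.
by apply: (@sqsummable_finite_support F) => g /negbTE gF; rewrite /restrict gF.
Qed.

Definition cutoff F x : l2 R G := Sub _ (restrict_sqsummable F (sval x)).

Definition basis r : l2 R G := Sub _ (restrict_sqsummable [:: r] (fun=> 1)).

Lemma basisE r g : sval (basis r) g = (g == r)%:R.
Proof. by rewrite /= /restrict inE; case: (g == r). Qed.

Lemma cutoff_lin F : linear (cutoff F).
Proof.
move=> k x y; apply: l2_eq => g; rewrite l2_lin /= /restrict.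
by case: (g \in F); rewrite ?mulr0 ?addr0.
Qed.

Lemma nrm_sub_cutoff_le F F' x : {subset F <= F'} ->
  nrm (x - cutoff F' x) <= nrm (x - cutoff F x).
Proof.
move=> FF; apply: nrm_l2_le => g; rewrite !l2_sub /= /restrict.
case: (boolP (g \in F)) => [/FF ->//|_].
by case: (g \in F') => //; rewrite subr0 subrr sqmod0 sqmod_ge0.
Qed.

Lemma nrm_sub_cutoff F x : nrm (x - cutoff F x) <= nrm x.
Proof.
apply: nrm_l2_le => g; rewrite l2_sub /= /restrict.
by case: (g \in F); rewrite ?subr0// subrr sqmod0 sqmod_ge0.
Qed.

Lemma lip_sub_cutoff F : lip (fun x => x - cutoff F x).
Proof.
have L : linear (fun x => x - cutoff F x).
  by move=> k x y; rewrite cutoff_lin opprD addrACA scalerBr.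
by apply: (lip_linear L ler01) => x; rewrite mul1r nrm_sub_cutoff.
Qed.

(** A finite partial sum within [e^2] of [sqsum] leaves a tail which is the squared distance to the
    cutoff. *)
Lemma cutoff_approx x (e : R) : 0 < e -> exists F, nrm (x - cutoff F x) < e.
Proof.
move=> e0; have e2 : 0 < e ^+ 2 by rewrite exprn_gt0.
have [_ [B [Bfin _] <-] HB] := ub_ereal_sup_adherent e2 (sqsum_fin x).
have /finite_seqP[F FB] := Bfin; exists F; subst B.
have f0 g : (0 <= (sqmod (sval x g))%:E)%E by rewrite lee_fin sqmod_ge0.
have := @esumID _ _ [set` F] setT _ (fun g _ => f0 g).
rewrite !setTI (esum_fset Bfin)// (esum_mkcond (~` _)) => E.
have E2 : (\esum_(g in [set: G]) if g \in ~` [set` F] then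
    (sqmod (sval x g))%:E else 0)%E = sqsum (sval (x - cutoff F x)).
  apply: eq_esum => g _; rewrite l2_sub /= /restrict in_setC mem_setE.
  by case: (g \in F) => /=; rewrite ?subr0// subrr sqmod0.
have {}HB : (sqsum (\val x) - (e ^+ 2)%:E <
    \sum_(g \in [set` F]) (sqmod (sval x g))%:E)%E by [].
have {}E : sqsum (\val x) = (\sum_(g \in [set` F]) (sqmod (sval x g))%:E +
    sqsum (\val (x - cutoff F x)%R))%E by rewrite -E2.
move: E HB; rewrite !l2normrE fsbig_finite//= sumEFin.
rewrite -EFinD -EFinB lte_fin => -[E HB].
rewrite -(@ltr_pXn2r _ 2) ?nnegrE ?nrm_ge0 ?ltW//.
by move: E HB; rewrite /nrm /= => -> ; lra.
Qed.

Lemma partial_sum_single (I : choiceType) (f : I -> R[i]^o) (i : I)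
    (J : {fset I}) :
  (forall k, k != i -> f k = 0) -> i \in J ->
  summability.partial_sum f J = f i.
Proof.
move=> f0 iJ; rewrite /summability.partial_sum (bigD1 [` iJ]%fset)//=.
rewrite big1 ?addr0// => k ki; apply: f0.
by apply: contraNneq ki => ki; apply/eqP/val_inj.
Qed.

Lemma sum_single (I : choiceType) (f : I -> R[i]^o) (i : I) :
  (forall k, k != i -> f k = 0) -> summability.sum f = f i.
Proof.
move=> f0; have totF := @summability.totally_filter I.
apply: cvg_lim; first exact: norm_hausdorff.
have near_f : \forall J \near summability.totally,
    summability.partial_sum f J = f i.
  exists [fset i]%fset => // J /= iJ.
  by apply: partial_sum_single => //; apply: (fsubsetP iJ); exact: fset11.
exact: cvg_near_cst near_f.
Qed.

Lemma l2dot_single x y r : (forall g, g != r -> sval y g = 0) ->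
  l2dot x y = sval x r * Num.conj (sval y r).
Proof.
move=> y0; rewrite /l2dot (@sum_single _ _ r)// => g gr.
by rewrite y0// conjC0 mulr0.
Qed.

End L2Coordinates.

Section CompactOperators.
Context {R : realType} {G : groupType}.
Implicit Types (x y : l2 R G) (T : l2 R G -> l2 R G).

Definition unit_op (r s : G) : l2 R G -> l2 R G :=
  fun x => sval x s *: basis r.

Lemma Re_normc_le (a b : R) : complex.Re `|(a +i* b)%C| <= `|a| + `|b|.
Proof.
rewrite (_ : complex.Re _ = Num.sqrt (sqmod (a +i* b)%C)); last first.
  by rewrite Defs.normcE.
rewrite -(@ler_pXn2r _ 2) ?nnegrE ?sqrtr_ge0 ?addr_ge0//.
rewrite sqr_sqrtr ?sqmod_ge0// /sqmod /= sqrrD !real_normK ?num_real//.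
by rewrite addrAC lerDl mulrn_wge0// mulr_ge0.
Qed.

(** With [x] a basis vector this contains the image of the unit ball under a matrix unit.
    Coefficients range over a square, so compactness comes from a product of intervals. *)
Lemma compact_disk (x : l2 R G) :
  compact [set (p.1 +i* p.2)%C *: x | p in `[-1, 1] `*` `[(-1 : R), 1]].
Proof.
apply: continuous_compact; last first.
  by apply: compact_setX; exact: segment_compact.
apply: continuous_subspaceT => -[a b] /=.
apply/cvgrPdist_lt => _ /gt0_complex[e e0 ->].
have nx : 0 < nrm x + 1 by rewrite ltr_wpDl// nrm_ge0.
have d0 : 0 < e / 2 / (nrm x + 1) by rewrite !divr_gt0.
exists (ball a (e / 2 / (nrm x + 1)), ball b (e / 2 / (nrm x + 1))).
  by split; exact: nbhsx_ballx.
move=> [a' b'] [/= h1 h2].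
rewrite nrm_lt -scalerBl nrmZ.
have h := Re_normc_le (a - a') (b - b').
apply: (@le_lt_trans _ _ ((`|a - a'| + `|b - b'|) * (nrm x + 1))).
  by rewrite ler_pM ?Re_normc_ge0 ?nrm_ge0// lerDl.
rewrite -ltr_pdivlMr//; apply: lt_le_trans (ltrD h1 h2) _.
by rewrite -mulrDl -splitr.
Qed.

Lemma sqmod_coord_le (x : l2 R G) s : sqmod (sval x s) <= nrm x ^+ 2.
Proof.
rewrite -lee_fin -[X in (_ <= (X ^+ 2)%:E)%E]/(l2normr x) -l2normrE.
apply: esum_ge; exists [set s]; first by split.
by rewrite fsbig_set1.
Qed.

Lemma compact_unit_op r s : compact_operator (unit_op r s).
Proof.
split; first by move=> k x y; rewrite /unit_op l2_lin scalerDl scalerA.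
have cD := @compact_disk (basis r).
rewrite precompactE; apply: (subclosed_compact _ cD).
  exact: closed_closure.
have /closure_id -> := compact_closed (@norm_hausdorff _ _) cD.
apply: closureS => _ [x /= x1 <-]; rewrite /unit_op.
have : sqmod (sval x s) <= 1.
  apply: le_trans (sqmod_coord_le x s) _.
  by rewrite expr_le1 ?nrm_ge0// -lecR -nrmE.
case: (sval x s) => a b; rewrite /sqmod /= => ab.
exists (a, b) => //; split; rewrite /= in_itv /=; apply/andP;
  have := sqr_ge0 a; have := sqr_ge0 b; split; nra.
Qed.

(** The open sets where [|y - cutoff F y| < e] cover the space and grow with [F]. Finitely many
    cover the closed image of the unit ball, and the concatenation of their index lists serves for
    all. *)
Lemma compact_operator_cutoff T (e : R) : compact_operator T -> 0 < e ->
  exists F, forall x, nrm (T x - cutoff F (T x)) <= e * nrm x.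
Proof.
move=> [TL Tc] e0.
have oC (F : seq G) : open [set y : l2 R G | nrm (y - cutoff F y) < e].
  have : closed [set y : l2 R G | e <= nrm (y - cutoff F y)].
    apply: (closed_preimage_lip (lip_sub_cutoff F) (S := [set y | e <= nrm y])).
    apply/closedP => a H; apply/ler_addgt0Pl => d /H[b /= eb ab].
    by have := nrm_dist a b 0; rewrite !subr0 nrmBC; lra.
  move=> /closed_openC; congr open; apply/seteqP; split=> y /=.
    by move=> /negP; rewrite -ltNge.
  by rewrite ltNge => /negP.
move: Tc; rewrite precompactE compact_cover => /(_ _ setT
  (fun F => [set y : l2 R G | nrm (y - cutoff F y) < e]) (fun F _ => oC F)).
case=> [y _|D _ Dcov].
  by have [F Fy] := cutoff_approx y e0; exists F.
exists (flatten D) => x; have [->|x0] := eqVneq x 0.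
  by rewrite (lin0 TL) (lin0 (cutoff_lin _)) subrr nrm0 mulr0.
have n0 : nrm x != 0 by apply: contraNneq x0 => /nrm_eq0 ->.
have np : 0 < nrm x by rewrite lt_def n0 nrm_ge0.
pose x' := (nrm x)^-1%:C%C *: x.
have x'1 : nrm x' = 1 by rewrite nrmZr ?invr_ge0 ?nrm_ge0// mulVf.
have [|F /= FD Fx'] := Dcov (T x').
  by apply: subset_closure; exists x' => //=; rewrite nrmE x'1.
have sub : {subset F <= flatten D}.
  by move=> g gF; apply/flattenP; exists F.
have := le_lt_trans (nrm_sub_cutoff_le (T x') sub) Fx'.
rewrite (linZ TL) (linZ (cutoff_lin _)) -scalerBr nrmZr ?invr_ge0 ?nrm_ge0//.
by rewrite mulrC ltr_pdivrMr// => /ltW.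
Qed.

End CompactOperators.

Section MatrixUnits.
Context {R : realType} {G : groupType} {K : cstarType R}
  {rho : K -> l2 R G -> l2 R G}.
Hypothesis rhoP : is_compact_operators rho.

Lemma rho_lin x : linear (fun a => rho a x).
Proof. by case: rhoP => _ L _ _ _ k a b; exact: L. Qed.

Lemma rhoM a b x : rho (a \* b) x = rho a (rho b x).
Proof. by case: rhoP. Qed.

Lemma rho_compact a : compact_operator (rho a).
Proof.
have [E _ _ _ _] := rhoP.
by have : range rho (rho a) by [exists a]; rewrite E.
Qed.

Lemma nrm_rhoP a (M : R) : 0 <= M ->
  nrm a <= M <-> forall x, nrm (rho a x) <= M * nrm x.
Proof.
move=> M0; have [_ _ _ _ /(_ a M%:C%C)] := rhoP; rewrite lecR => /(_ M0).
rewrite nrmE lecR => -[H1 H2]; split=> [/H1 H x|H].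
  by have := H x; rewrite !nrmE -rmorphM lecR.
by apply: H2 => x; rewrite !nrmE -rmorphM lecR.
Qed.

Lemma rho_inj a b : (forall x, rho a x = rho b x) -> a = b.
Proof.
move=> ab; apply/eqP; rewrite -subr_eq0; apply/eqP/nrm_eq0/eqP.
rewrite eq_le nrm_ge0 andbT; apply/(nrm_rhoP _ (lexx 0)) => x.
by rewrite (linB (rho_lin x)) ab subrr nrm0 mul0r.
Qed.

Lemma matrix_units : exists e : G -> G -> K, forall r s x,
  rho (e r s) x = unit_op r s x.
Proof.
have [rE _ _ _ _] := rhoP.
have /choice[e eP] (i : G * G) : exists a, rho a = unit_op i.1 i.2.
  have : range rho (unit_op i.1 i.2) by rewrite rE; exact: compact_unit_op.
  by case=> a _ <-; exists a.
by exists (fun r s => e (r, s)) => r s x; rewrite eP.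
Qed.

Context {e : G -> G -> K}.
Hypothesis eE : forall r s x, rho (e r s) x = unit_op r s x.

Lemma unitM r s u v : e r s \* e u v = if s == u then e r v else 0.
Proof.
apply: rho_inj => x; rewrite rhoM !eE /unit_op.
rewrite l2_scale basisE.
case: eqP => _; first by rewrite eE mulr1.
by rewrite (lin0 (rho_lin x)) mulr0 scale0r.
Qed.

Lemma unit_star r s : (e r s)^* = e s r.
Proof.
have [_ _ _ adj _] := rhoP.
apply: rho_inj => x; apply: l2_eq => g; have := adj (e r s) x (basis g).
rewrite (@l2dot_single _ _ _ _ g); last first.
  by move=> h; rewrite basisE => /negbTE ->.
rewrite (@l2dot_single _ _ _ _ r); last first.
  by move=> h; rewrite eE l2_scale !basisE => /negbTE ->; rewrite mulr0.
rewrite !eE /unit_op.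
by rewrite !l2_scale !basisE !eqxx mulr1 !conjC_nat mulr1 eq_sym.
Qed.

(** [undup] because a repeated index would spoil idempotence. *)
Definition unit_proj (F : seq G) : K := \sum_(r <- undup F) e r r.

Lemma rho_unit_proj F x : rho (unit_proj F) x = cutoff F x.
Proof.
apply: l2_eq => g; rewrite /unit_proj (lin_sum (rho_lin x)).
have gL : linear (fun y : l2 R G => sval y g : R[i]^o) by [].
rewrite (lin_sum gL) /= /restrict.
rewrite (eq_bigr (fun r => sval x r * (g == r)%:R : R[i]^o)); last first.
  by move=> r _; rewrite eE -basisE.
case: ifPn => gF; last first.
  rewrite big1_seq// => r /andP[_]; rewrite mem_undup => rF.
  by case: eqP gF => [->|_ _]; rewrite ?rF// mulr0.
rewrite (bigD1_seq g) ?mem_undup ?undup_uniq//= eqxx mulr1 big1 ?addr0//.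
by move=> r; rewrite eq_sym => /negbTE ->; rewrite mulr0.
Qed.

Lemma unit_proj_star F : (unit_proj F)^* = unit_proj F.
Proof. by rewrite cstar_sum; apply: eq_bigr => r _; exact: unit_star. Qed.

Lemma unit_proj_idem F : unit_proj F \* unit_proj F = unit_proj F.
Proof.
apply: rho_inj => x; rewrite rhoM !rho_unit_proj; apply: l2_eq => g /=.
by rewrite /restrict; case: (g \in F).
Qed.

(** Cutoffs approximate [k^*] from the left; adjoints move the projection to the right of [k]. *)
Lemma unit_proj_approx k (d : R) : 0 < d ->
  exists F, nrm (k - k \* unit_proj F) <= d.
Proof.
move=> d0; have [F HF] := compact_operator_cutoff (rho_compact k^*) d0.
exists F; rewrite -nrm_cstar cstarB cstarM unit_proj_star.
apply/(nrm_rhoP _ (ltW d0)) => x.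
by rewrite (linB (rho_lin x)) rhoM rho_unit_proj.
Qed.

Lemma unit_corner k r s :
  e r r \* k \* e s s = sval (rho k (basis s)) r *: e r s.
Proof.
have [kL _] := rho_compact k; apply: rho_inj => x.
rewrite (linZ (rho_lin x)) !rhoM !eE /unit_op (linZ kL) scalerA mulrC.
by [].
Qed.

End MatrixUnits.

(** * Tensor products with the compact operators *)

Section TensorProducts.
Context {R : realType} {G : groupType} {A K T : cstarType R}
  {rho : K -> l2 R G -> l2 R G} {tens : A -> K -> T}.
Hypothesis rhoP : is_compact_operators rho.
Hypothesis tensP : is_tensor_product tens.

Let tens_linr a : linear (tens a). Proof. by case: tensP => -[]. Qed.
Let tens_linl k : linear (tens^~ k). Proof. by case: tensP => -[]. Qed.
Let tensM a a' k k' : tens a k \* tens a' k' = tens (a \* a') (k \* k').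
Proof. by case: tensP. Qed.
Let tens_star a k : (tens a k)^* = tens a^* k^*. Proof. by case: tensP. Qed.

(** The averaging of [nrm_sqrt_mul] in the second tensor factor: the two unitaries preserve [b^* b],
    hence the norm of [a (x) b]. *)
Lemma nrm_tens_mul_sa1 a h b : h^* = h -> nrm h <= 1 ->
  nrm (tens a (h \* b)) <= nrm (tens a b).
Proof.
move=> hs h1; have [||z [zs _ zE zc]] := @cstar_sqrt R K (h \* h).
- by rewrite cstarM hs.
- by apply: le_trans (nrmM _ _) _; rewrite mulr_ile1// nrm_ge0.
have hz : h \* z = z \* h by apply: zc; rewrite cmulA.
pose w c := h \* b + c *: (b - z \* b).
have nw c : Num.conj c = - c -> c * c = -1 ->
    nrm (tens a (w c)) = nrm (tens a b).
  move=> cs cc; apply: nrm_eq_cstarM; rewrite !tens_star !tensM.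
  by congr (tens _ _); exact: unitary_cstarM.
have ii : 'i * 'i = -1 :> R[i] by rewrite -expr2 sqrCi.
have H : tens a (h \* b) + tens a (h \* b) = tens a (w 'i) + tens a (w (- 'i)).
  by rewrite -!(linD (tens_linr _)) /w addrACA scaleNr subrr addr0.
have ni : nrm (tens a (w (- 'i))) = nrm (tens a b).
  by apply: nw; rewrite ?mulrNN// rmorphN/= conjCi.
rewrite -(ler_pMn2r (ltn0Sn 1)) -nrm_double H mulr2n.
by rewrite -{1}(nw 'i (conjCi _) ii) -ni nrmD.
Qed.

Lemma nrm_tens_mul_sa a h b : h^* = h ->
  nrm (tens a (h \* b)) <= nrm h * nrm (tens a b).
Proof.
move=> hs; have [->|h0] := eqVneq h 0.
  by rewrite cmul0x (lin0 (tens_linr _)) !nrm0 mul0r.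
have n0 : 0 < nrm h.
  by rewrite lt_def nrm_ge0 andbT; apply: contraNneq h0 => /nrm_eq0 ->.
have := @nrm_tens_mul_sa1 a ((nrm h)^-1%:C%C *: h) b.
rewrite cstarZr hs nrm_normalize// => /(_ erefl (lexx _)).
rewrite cmulZl (linZ (tens_linr _)) nrmZr ?invr_ge0 ?nrm_ge0//.
by rewrite mulrC ler_pdivrMr// mulrC.
Qed.

(** Here [2 k = s1 + i s2] with both parts selfadjoint of norm at most [2 |k|], which is where the
    factor 2 comes from. *)
Lemma nrm_tens_mul a k b :
  nrm (tens a (k \* b)) <= 2 * nrm k * nrm (tens a b).
Proof.
pose s1 := k + k^*; pose s2 := - 'i *: (k - k^*).
have s1s : s1^* = s1 by rewrite cstarD cstarK addrC.
have s2s : s2^* = s2.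
  rewrite cstarZ cstarB cstarK rmorphN/= conjCi opprK.
  by rewrite /s2 scaleNr -scalerN opprB.
have n1 : nrm s1 <= 2 * nrm k.
  by apply: le_trans (nrmD _ _) _; rewrite nrm_cstar; lra.
have n2 : nrm s2 <= 2 * nrm k.
  rewrite /s2 scaleNr nrmN nrmZi; apply: le_trans (nrmB _ _) _.
  by rewrite nrm_cstar; lra.
have E : k + k = s1 + 'i *: s2.
  rewrite /s2 scalerA mulrN -expr2 sqrCi opprK scale1r /s1 addrACA addrN.
  by rewrite addr0.
rewrite -(ler_pMn2r (ltn0Sn 1)) -nrm_double -(linD (tens_linr _)) -cmulDl E.
rewrite cmulDl cmulZl (linD (tens_linr _)) (linZ (tens_linr _)).
apply: le_trans (nrmD _ _) _; rewrite nrmZi mulr2n.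
apply: lerD; apply: le_trans (nrm_tens_mul_sa _ _ _) _ => //;
  by rewrite ler_wpM2r ?nrm_ge0.
Qed.

Lemma tensor_corner_inj a k : k != 0 -> tens a k = 0 -> a = 0.
Proof.
move=> k0 ak; have [_ _ _ inj _] := tensP.
apply: (inj 1%N (fun=> a) (fun=> k) _ _ ord0); last by rewrite big_ord1.
move=> c; rewrite big_ord1 => /eqP; rewrite scaler_eq0 (negbTE k0) orbF.
by move=> /eqP c0 i; rewrite ord1.
Qed.

Lemma tensor_matrix_system : exists m : A -> G -> G -> T,
  [/\ matrix_system m, closed_span_full (matrix_entries m) &
      forall a, m a 1%g 1%g = 0 -> a = 0].
Proof.
have [e eE] := matrix_units rhoP.
have eM := unitM rhoP eE; have eS := unit_star rhoP eE.
pose P := @unit_proj R G K e.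
have PS F : (P F)^* = P F := unit_proj_star rhoP eE F.
have approx a k (d : R) : 0 < d ->
    exists F, nrm (tens a k - tens a (k \* P F)) <= d.
  (* For [w = k - k P] one has [w w^* = w k^*], so [|a (x) w|^2 <= 2 |w| C]. The bound
     [d^2 / (2 C + 1)] on [|w|] suffices, the 1 keeping the denominator positive. *)
  move=> d0; pose C := nrm (tens (a \* a^*) k^*).
  have C0 : 0 <= C := nrm_ge0 _.
  have C1 : 0 < 2 * C + 1 by lra.
  have [F HF] := unit_proj_approx rhoP eE k (divr_gt0 (exprn_gt0 2 d0) C1).
  exists F; rewrite -(linB (tens_linr _)); set w := k - _ in HF *.
  have wP : w \* P F = 0.
    by rewrite cmulBl -cmulA (unit_proj_idem rhoP eE) subrr.
  have ww : w \* w^* = w \* k^*.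
    by rewrite [in LHS]/w cstarB cmulBr cstarM PS cmulA wP cmul0x subr0.
  rewrite -(@ler_pXn2r _ 2) ?nnegrE ?nrm_ge0 ?(ltW d0)//.
  rewrite -nrm_Mcstar tens_star tensM ww.
  apply: le_trans (nrm_tens_mul _ _ _) _.
  move: HF; rewrite ler_pdivlMr// -/C; have := nrm_ge0 w; nra.
exists (fun a r s => tens a (e r s)); split; last first.
- move=> a; apply: tensor_corner_inj; apply/eqP => e0.
  have := congr1 (fun k => sval (rho k (basis 1%g)) 1%g) e0.
  rewrite (lin0 (rho_lin rhoP _)) eE l2_scale !basisE eqxx mulr1 => E.
  by have /eqP : (1 : R[i]) = 0 := E; rewrite oner_eq0.
- have [_ _ _ _ Tf] := tensP => V VS mV; apply: Tf => // _ [a _ [k _ <-]].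
  have [cV V0 VD] := VS.
  have Vsum (I : Type) (l : seq I) (f : I -> T) :
      (forall i, V (f i)) -> V (\sum_(i <- l) f i).
    move=> Vf; elim: l => [|i l IH]; rewrite ?big_nil ?big_cons//.
    by rewrite -[f i]scale1r; exact: VD.
  have lim (W : set T) b k' : closed_subspace W ->
      (forall F, W (tens b (k' \* P F))) -> W (tens b k').
    move=> [/closedP cW _ _] Wk; apply: cW => d d0.
    have [F HF] := approx b k' _ (divr_gt0 d0 (ltr0n _ 2)).
    exists (tens b (k' \* P F)) => //; apply: le_lt_trans HF _.
    by rewrite ltr_pdivrMr// ltr_pMr//; lra.
  have VP F b k' : V (tens b (P F \* k')).
    apply: lim => // F'; rewrite /P /unit_proj.
    rewrite (lin_sum (cmul_linl _)) (lin_sum (cmul_linl _)).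
    rewrite (lin_sum (tens_linr _)); apply: (Vsum) => r.
    rewrite (lin_sum (cmul_linr _)) (lin_sum (tens_linr _)); apply: (Vsum) => s.
    rewrite (unit_corner rhoP eE) (linZ (tens_linr _)) -[_ *: _]addr0.
    by apply: VD => //; apply: mV; exists (b, r, s).
  (* [approx] truncates on the right only; truncation on the left is obtained through adjoints. *)
  rewrite -(cstarK (tens a k)) tens_star.
  apply: (lim [set x | V x^*]) => [|F]; first exact: closed_subspace_star.
  by rewrite /= tens_star cstarM PS !cstarK.
- split=> [r s|a b r s u v|a r s]; first exact: tens_linl.
    by rewrite tensM eM; case: eqP => // _; rewrite (lin0 (tens_linr _)).
  by rewrite tens_star eS.
Qed.

End TensorProducts.

(** * Sums of projections *)

Section SumsOfProjections.
Context {R : realType} {A : cstarType R}.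
Implicit Types p q g : A.

(** For [v = x + i y], commutation gives [v^* v = x^2 + y^2 = 0]. Then [x = - i y], and
    selfadjointness also gives [x = i y]. *)
Lemma sum_squares_eq0 (x y : A) : x^* = x -> y^* = y -> x \* y = y \* x ->
  x \* x + y \* y = 0 -> y = 0.
Proof.
move=> xs ys xy E; have v0 : x + 'i *: y = 0.
  apply: cstarM_eq0; rewrite cstarD cstarZ conjCi xs ys scaleNr.
  rewrite cmulDl !cmulDr !cmulNx !cmulZl !cmulZr xy scalerA -expr2 sqrCi.
  by rewrite scaleN1r opprK addrA addrK.
have xE : x = - ('i *: y) by apply/eqP; rewrite -addr_eq0 v0.
have xE' : x = 'i *: y.
  by rewrite -xs {1}xE cstarN cstarZ conjCi ys scaleNr opprK.
have x0 : nrm x *+ 2 = 0 by rewrite -nrm_double {1}xE xE' addNr nrm0.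
by apply: nrm_eq0; rewrite -nrmZi -xE'; move: x0; rewrite mulr2n; lra.
Qed.

Lemma nrm_projection q : projection q -> nrm q <= 1.
Proof.
move=> [qq qs]; have := nrm_cstarM q; rewrite qs qq expr2 => E.
have [->//|q0] := eqVneq (nrm q) 0.
by move: E => /eqP; rewrite -subr_eq0 -{1}[nrm q]mulr1 -mulrBr mulf_eq0
  (negbTE q0) subr_eq0 => /eqP <-.
Qed.

(* With [q] as the unit, [1] is an extreme point of the unit ball.  As
   [|1 + g^2| <= 1] there is a selfadjoint [y] with [y^2 = 1 - (1 + g^2)^2],
   while [(1 + g^2)^2 - 1 = g^2 (2 + g^2)] is a square as well. *)
Lemma projection_extreme q g : projection q -> g^* = g -> q \* g = g ->
  nrm (q + g) <= 1 -> nrm (q - g) <= 1 -> g = 0.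
Proof.
move=> [qq qs] gs qg n1 n2.
have gq : g \* q = g by rewrite -{1}gs -{1}qs -cstarM qg gs.
have q1 : nrm q <= 1 by exact: nrm_projection.
have g1 : nrm g <= 1.
  have E : g + g = (q + g) - (q - g).
    by rewrite opprB [q + g]addrC addrACA subrr addr0.
  rewrite -(ler_pMn2r (ltn0Sn 1)) -nrm_double E.
  by apply: le_trans (nrmB _ _) _; rewrite mulr2n lerD.
pose X := g \* g.
have Xs : X^* = X by rewrite cstarM gs.
have qX : q \* X = X by rewrite cmulA qg.
have Xq : X \* q = X by rewrite -cmulA gq.
have gX : g \* X = X \* g by rewrite cmulA.
have X1 : nrm X <= 1.
  by apply: le_trans (nrmM _ _) _; rewrite mulr_ile1 ?nrm_ge0.
(* [2 (q + g^2) = (q + g)^2 + (q - g)^2]. *)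
have nX : nrm (q + X) <= 1.
  have E : (q + X) + (q + X) = (q + g) \* (q + g) + (q - g) \* (q - g).
    rewrite cmulBl !cmulBr cmulDl !cmulDr qq qg gq -/X opprB.
    rewrite [RHS]addrACA [q + g + _]addrACA subrr addr0.
    by rewrite [g + X + _]addrC [X - g + _]addrA subrK addrACA.
  rewrite -(ler_pMn2r (ltn0Sn 1)) -nrm_double E.
  apply: le_trans (nrmD _ _) _; rewrite mulr2n lerD//;
    by apply: le_trans (nrmM _ _) _; rewrite mulr_ile1 ?nrm_ge0.
pose w1 := (q + X) \* (q + X).
have w1E : w1 = q + X + (X + X \* X) by rewrite /w1 cmulDl !cmulDr qq qX Xq.
have [||z1 [z1s _ z1E z1c]] := @cstar_sqrt R A w1.
- by rewrite cstarM cstarD qs Xs.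
- by apply: le_trans (nrmM _ _) _; rewrite mulr_ile1 ?nrm_ge0.
(* Chosen so that [3 X (q - w2) = 2 X + X^2], which makes [W = sqrt 3 g (1 - z2)] a square root of
   it; the factor [1/3] keeps [w2] in the unit ball. *)
pose w2 := 3^-1%:C%C *: (q - X).
have h3 : 0 <= 3^-1 :> R by rewrite invr_ge0.
have [||z2 [z2s _ z2E z2c]] := @cstar_sqrt R A w2.
- by rewrite cstarZr cstarB qs Xs.
- rewrite nrmZr// mulrC ler_pdivrMr// mul1r; apply: le_trans (nrmB _ _) _.
  by lra.
have comm1 a : a \* q = q \* a -> a \* X = X \* a -> a \* z1 = z1 \* a.
  move=> aq aX; apply: z1c; rewrite /w1.
  have aqX : a \* (q + X) = (q + X) \* a by rewrite cmulDr cmulDl aq aX.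
  by rewrite cmulA aqX -cmulA aqX cmulA.
have comm2 a : a \* q = q \* a -> a \* X = X \* a -> a \* z2 = z2 \* a.
  by move=> aq aX; apply: z2c; rewrite cmulZr cmulZl cmulBr cmulBl aq aX.
have gz1 : g \* z1 = z1 \* g by apply: comm1; rewrite ?gX ?gq ?qg.
have gz2 : g \* z2 = z2 \* g by apply: comm2; rewrite ?gX ?gq ?qg.
have qz1 : q \* z1 = z1 \* q by apply: comm1; rewrite ?qX ?Xq.
have qz2 : q \* z2 = z2 \* q by apply: comm2; rewrite ?qX ?Xq.
have z12 : z1 \* z2 = z2 \* z1.
  apply: comm2 => //; by rewrite /X cmulA -gz1 -cmulA -gz1 cmulA.
pose y := q - q \* z1.
have ys : y^* = y by rewrite cstarB cstarM qs z1s -qz1.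
have yy : y \* y = q - w1.
  have qw : q \* w1 = w1 by rewrite w1E !cmulDr qq !qX cmulA qX.
  rewrite -qw -z1E /y cmulBl !cmulBr cmulDr qq [q \* (q \* z1)]cmulA qq.
  rewrite -[q \* z1 \* q]cmulA -qz1 [q \* (q \* z1)]cmulA qq.
  rewrite -[q \* z1 \* _]cmulA [z1 \* (q \* z1)]cmulA -qz1 !cmulA qq.
  by rewrite -addrA -opprD addrA.
pose W := (Num.sqrt 3)%:C%C *: (g - g \* z2).
have Ws : W^* = W by rewrite cstarZr cstarB cstarM gs z2s -gz2.
have WW : W \* W = X + X + X \* X.
  rewrite cmulZl cmulZr scalerA -rmorphM /= -expr2 sqr_sqrtr//.
  have -> : (g - g \* z2) \* (g - g \* z2) = X - X \* (z2 + z2 - z2 \* z2).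
    have e1 : (g \* z2) \* g = X \* z2 by rewrite -cmulA -gz2 cmulA.
    rewrite cmulBl !cmulBr -/X cmulDr cmulA -/X e1 cmulA e1 -cmulA.
    by rewrite -addrA -opprD addrA.
  rewrite z2E cmulZr scalerBr scalerA -rmorphM/= mulfV// scale1r cmulBr Xq.
  rewrite rmorph_nat scaler_nat opprB mulrS mulr2n addrCA [X in _ = X]addrC.
  by congr (_ + _); rewrite addrC addKr.
have yg : y \* g = g \* y.
  by rewrite cmulBl cmulBr qg gq -cmulA -gz1 cmulA qg cmulA gq.
have yz2 : y \* z2 = z2 \* y.
  by rewrite cmulBl cmulBr qz2 -cmulA z12 cmulA qz2 -cmulA.
have yW : y \* W = W \* y.
  by rewrite cmulZl cmulZr cmulBl cmulBr cmulA yg -cmulA yz2 -cmulA.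
have W0 : W = 0.
  apply: (sum_squares_eq0 ys Ws yW); rewrite yy WW w1E.
  have -> : q + X + (X + X \* X) = q + (X + X + X \* X) by rewrite -!addrA.
  by move: (X + X + _) => S; rewrite opprD addrA subrr add0r addNr.
have XX : X + X = - (X \* X).
  by apply/eqP; rewrite -addr_eq0 -WW W0 cmul0x.
have : nrm X *+ 2 <= nrm X.
  rewrite -nrm_double XX nrmN; apply: le_trans (nrmM _ _) _.
  by rewrite -[leRHS]mulr1 ler_wpM2l ?nrm_ge0.
rewrite mulr2n; have := nrm_ge0 X => X0 X2.
apply: cstarM_eq0; rewrite gs; apply: nrm_eq0; rewrite -/X; lra.
Qed.

(** The element is [q (1 - 2 r) q], where [1 - 2 r] is a selfadjoint unitary. *)
Lemma nrm_corner q r : projection q -> projection r ->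
  nrm (q - (q \* r \* q + q \* r \* q)) <= 1.
Proof.
move=> qP rP; have q1 := nrm_projection qP; have [qq qs] := qP.
have [rr rs] := rP; pose t := r \* q; pose c := q - (t + t).
have ts : t^* = q \* r by rewrite cstarM qs rs.
have tt : t^* \* t = q \* r \* q by rewrite ts /t cmulA -(cmulA q) rr.
have qt : q \* t = q \* r \* q by rewrite /t cmulA.
have tq : t^* \* q = q \* r \* q by rewrite ts.
have nc : nrm c = nrm q.
  apply: nrm_eq_cstarM; rewrite /c cstarB cstarD qs cmulBl !cmulBr cmulDl.
  rewrite !cmulDr !cmulDl tt qt tq qq; set h := q \* r \* q + _.
  by rewrite opprB addrK subrK.
have -> : q - (q \* r \* q + q \* r \* q) = q \* c.
  by rewrite cmulBr cmulDr qq qt.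
by apply: le_trans (nrmM _ _) _; rewrite nc mulr_ile1 ?nrm_ge0.
Qed.

(* For [q = q_e], [k = q - q p q] equals [- \sum_(i != e) q q_i q], so that
   both [k] and [- k] are positive in the corner of [q]. *)
Lemma sum_projections_absorb (I : eqType) (l : seq I) (qs : I -> A) (p : A) e :
  (forall i, projection (qs i)) -> projection p ->
  \sum_(i <- l) qs i = p -> e \in l -> p \* qs e = qs e.
Proof.
move=> qP pP pE el; move: pE; rewrite (big_rem _ el)/= => pE.
set q := qs e; set l' := rem e l in pE.
have [qq qss] := qP e; have [pp ps] := pP.
pose k := q - q \* p \* q.
have kE : k = - \sum_(i <- l') q \* qs i \* q.
  rewrite /k -pE cmulDr cmulDl qq qq opprD addrA subrr add0r.
  by rewrite (lin_sum (cmul_linr _)) (lin_sum (cmul_linl _)).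
suff k0 : k = 0.
  apply/esym/eqP; rewrite -subr_eq0; apply/eqP/cstarM_eq0.
  rewrite cstarB cstarM qss ps cmulBl !cmulBr qq !cmulA -[_ \* p \* p]cmulA.
  by rewrite pp -/k k0 subrr subr0.
pose M := (size l')%:R : R.
(* [M q + 2 k] is the sum of the [M] terms [q - 2 q q_i q] with [i] in [l'], each covered by
   [nrm_corner]. *)
have sum_le : nrm (M%:C%C *: q + (k + k)) <= M.
  rewrite kE -opprD -big_split /= /M rmorph_nat scaler_nat.
  elim: l' {pE kE M} => [|i l' IH] /=.
    by rewrite big_nil mulr0n subr0 nrm0.
  rewrite big_cons mulrS opprD addrACA [leRHS]mulrS.
  by apply: le_trans (nrmD _ _) _; rewrite lerD// nrm_corner.
have [M0|M0] := eqVneq (size l') 0%N.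
  by rewrite kE (size0nil M0) big_nil oppr0.
have M1 : 1 <= M by rewrite ler1n lt0n.
have Mp : 0 < M by lra.
have kk : nrm (q - (k + k)) <= 1.
  have -> : q - (k + k) = - (q - (q \* p \* q + q \* p \* q)).
    rewrite /k; move: (q \* p \* q) => h.
    by rewrite opprD !opprB addrA [q + (h - q)]addrC subrK addrA.
  by rewrite nrmN nrm_corner.
have dif_le : nrm (M%:C%C *: q - (k + k)) <= M.
  have -> : M%:C%C *: q - (k + k) = (M - 1)%:C%C *: q + (q - (k + k)).
    by rewrite rmorphB /= scalerBl scale1r [RHS]addrA subrK.
  have M10 : 0 <= M - 1 by rewrite subr_ge0.
  apply: le_trans (nrmD _ _) _; rewrite nrmZr ?subr_ge0//.
  have := ler_wpM2l M10 (nrm_projection (qP e)).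
  by rewrite mulr1; lra.
(* Dividing both estimates by [M] gives [|q + g| <= 1] and [|q - g| <= 1], so extremality
   applies. *)
pose g := M^-1%:C%C *: (k + k).
have Mi : 0 <= M^-1 by rewrite invr_ge0 ltW.
have scale x : nrm (M%:C%C *: q + x) <= M -> nrm (q + M^-1%:C%C *: x) <= 1.
  move=> H; have -> : q + M^-1%:C%C *: x = M^-1%:C%C *: (M%:C%C *: q + x).
    by rewrite scalerDr scalerA -rmorphM /= mulVf ?gt_eqF// scale1r.
  by rewrite nrmZr// mulrC ler_pdivrMr// mul1r.
have ks : k^* = k by rewrite cstarB !cstarM qss ps cmulA.
have qk : q \* k = k by rewrite cmulBr !cmulA qq.
have g0 : g = 0.
  apply: (projection_extreme (qP e)).
  - by rewrite cstarZr cstarD ks.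
  - by rewrite cmulZr cmulDr qk.
  - exact: scale.
  - by rewrite -scalerN; exact: scale.
have := congr1 (@nrm _ A) g0; rewrite nrmZr// nrm_double nrm0 => /eqP.
rewrite mulf_eq0 invr_eq0 (gt_eqF Mp) /= mulrn_eq0 /= => /eqP; exact: nrm_eq0.
Qed.

End SumsOfProjections.

(** * Graph algebras *)

Section CuntzKriegerFamilies.
Context {R : realType} {E : digraph} {A : cstarType R}
  {s : edge E -> A} {p : vertex E -> A}.
Hypotheses (E_fin : row_finite E) (sp : CK_family s p).

Lemma CK_edge_rng f : s f \* p (rng f) = s f.
Proof. by case: sp => sI _ _ <- _; rewrite cmulA sI. Qed.

(** [src f] emits [f], so its projection is a finite sum of range projections and absorbs the one of
    [f]. *)
Lemma CK_src_edge f : p (src f) \* s f = s f.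
Proof.
have [sI pP _ _ pE] := sp.
have qP g : projection (s g \* (s g)^*).
  by split; rewrite ?cmulA ?sI// cstarM cstarK.
have nsink : ~ is_sink (src f) by move=> /(_ f).
have := pE _ nsink; rewrite fsbig_finite// => /esym.
move=> /(sum_projections_absorb qP (pP _)) H.
rewrite -{1}(sI f) cmulA H ?sI//.
by rewrite in_fset_set//; apply/mem_set.
Qed.

Lemma CK_edge_star_src f : (s f)^* \* p (src f) = (s f)^*.
Proof.
have [_ pP _ _ _] := sp; have [_ ps] := pP (src f).
by rewrite -{1}ps -cstarM CK_src_edge.
Qed.

End CuntzKriegerFamilies.

Section GraphAlgebras.
Context {R : realType} {E : digraph} {A : cstarType R}
  {s : edge E -> A} {p : vertex E -> A}.
Hypotheses (E_fin : row_finite E) (A_graph : is_graph_algebra s p).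

Lemma graph_algebra_ind (W : set A) : closed_star_subalgebra W ->
  (forall f, W (s f)) -> (forall v, W (p v)) -> forall a, W a.
Proof.
have [_ gen _] := A_graph => WS Ws Wp a.
by apply: (generates_ind gen WS) => _ [[f _ <-]|[v _ <-]].
Qed.

Lemma graph_algebra_hom_eq (B : cstarType R) (phi psi : A -> B) :
  star_hom phi -> star_hom psi -> (forall f, phi (s f) = psi (s f)) ->
  (forall v, phi (p v) = psi (p v)) -> forall a, phi a = psi a.
Proof.
move=> H1 H2 eqs eqp; apply: graph_algebra_ind => //; split.
- exact: closed_subspace_eq (hom_lin H1) (lip_hom H1) (hom_lin H2) (lip_hom H2).
- by move=> a b /= ea eb; rewrite (homM H1) (homM H2) ea eb.
- by move=> a /= ea; rewrite (hom_star H1) (hom_star H2) ea.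
Qed.

(* Every generator [x], and its adjoint, satisfies [x = x p_w] for some [w]. *)
Lemma graph_algebra_annihilate (B : cstarType R) (psi : A -> B) (y : B) :
  star_hom psi -> (forall v, psi (p v) \* y = 0) -> forall a, psi a \* y = 0.
Proof.
move=> H py; have [CK _ _] := A_graph; have [_ pP _ _ _] := CK.
have absorb x v : x \* p v = x -> psi x \* y = 0.
  by move=> <-; rewrite (homM H) -cmulA py cmulx0.
have fL : linear (fun a => psi a \* y).
  by move=> k u v; rewrite (hom_lin H) (cmul_linl y).
have W0 : closed_subspace [set a | psi a \* y = 0].
  apply: (closed_subspace_eq (g := fun=> 0)) => //.
  - exact: lip_comp (lip_cmull y) (lip_hom H).
  - by move=> k u v; rewrite scaler0 addr0.
  - exact: lip_cst.
(* The clause for [a^*] makes the induction predicate stable under adjoints and products. *)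
suff W a : psi a \* y = 0 /\ psi a^* \* y = 0 by move=> a; case: (W a).
move: a; apply: (graph_algebra_ind
  (W := [set a | psi a \* y = 0 /\ psi a^* \* y = 0])).
- split; first exact: closed_subspaceI W0 (closed_subspace_star W0).
    move=> a b [_ a2] [b1 _] /=.
    by rewrite cstarM !(homM H) -!cmulA a2 b1 !cmulx0.
  by move=> a [a1 a2] /=; rewrite cstarK.
- move=> f; split; [exact: absorb (CK_edge_rng CK f)|].
  exact: absorb (CK_edge_star_src E_fin CK f).
- move=> v; have [pp ps] := pP v.
  by split; apply: (absorb _ v); rewrite ?ps.
Qed.

End GraphAlgebras.

Section SkewProducts.
Context {G : groupType} {E : digraph} (c : edge E -> G).

Lemma skew_product_sink (v : vertex E) (u : G) :
  is_sink (E := E) v <-> is_sink (E := skew_product c) (v, u).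
Proof.
split=> [H [f r] [fv _]|H f fv]; first exact: H fv.
by apply: (H (f, (c f)^-1 * u)%g); rewrite /= fv mulgA mulgV mul1g.
Qed.

Lemma skew_product_sum (V : nmodType) (F : edge (skew_product c) -> V) v u :
  \sum_(e \in [set e : edge (skew_product c) | src e = (v, u)]) F e =
  \sum_(f \in [set f : edge E | src f = v]) F (f, (c f)^-1 * u)%g.
Proof.
apply: (reindex_fsbig
  (fun f : edge E => (f, (c f)^-1 * u)%g : edge (skew_product c))).
split.
- by move=> f /= ->; rewrite mulgA mulgV mul1g.
- by move=> f g _ _ [].
- by move=> [f r] /= [fv <-]; exists f => //; rewrite mulgA mulVg mul1g.
Qed.

End SkewProducts.

(** * The crossed product *)

Section CrossedProducts.
Context {R : realType} {G : groupType} {B : cstarType R} {gamma : G -> B -> B}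
  {D : cstarType R} {j : G -> B -> D}.
Hypotheses (gammaP : is_action gamma) (jP : twisted_hom gamma j).

Lemma action_hom t : star_hom (gamma t). Proof. by case: gammaP. Qed.
Lemma action1 b : gamma 1%g b = b. Proof. by case: gammaP. Qed.
Lemma actionM s t b : gamma s (gamma t b) = gamma (s * t)%g b.
Proof. by case: gammaP. Qed.
Lemma actionK t b : gamma t (gamma t^-1%g b) = b.
Proof. by rewrite actionM mulgV action1. Qed.

Lemma twisted_lin t : linear (j t). Proof. by case: jP. Qed.
Lemma twistedM s t a b : j s a \* j t b = j (s * t)%g (a \* gamma s b).
Proof. by case: jP. Qed.
Lemma twisted_star t a : (j t a)^* = j t^-1%g (gamma t^-1%g a^*).
Proof. by case: jP. Qed.

Lemma twisted_hom1 : star_hom (j 1%g).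
Proof.
split=> [|a b|a]; first exact: twisted_lin.
  by rewrite twistedM mulg1 action1.
by rewrite twisted_star invg1 action1.
Qed.

Lemma twisted_mul_star t a b : j t a \* (j t b)^* = j 1%g (a \* b^*).
Proof. by rewrite twisted_star twistedM mulgV actionK. Qed.

Lemma lip_twisted t : lip (j t).
Proof.
apply: (lip_linear (twisted_lin t) ler01) => b; rewrite mul1r.
rewrite -(@ler_pXn2r _ 2) ?nnegrE ?nrm_ge0// -nrm_Mcstar twisted_mul_star.
apply: le_trans (hom_contractive twisted_hom1 _) _.
by rewrite nrm_Mcstar.
Qed.

(** These are the canonical unitaries of the crossed product,
    [u_t (b delta_s) = gamma_t(b) delta_(ts)]. *)
Lemma twisted_rep :
  closed_span_full [set j t a | t in [set: G] & a in [set: B]] ->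
  exists U, unitary_rep U /\
    forall t s b, U t (j s b) = j (t * s)%g (gamma t b).
Proof.
move=> jf; pose x (i : G * B) := j i.1 i.2.
pose act (t : G) (i : G * B) := ((t * i.1)%g, gamma t i.2).
have xf : closed_span_full (range x).
  by move=> V VS xV; apply: jf => // _ [t _ [b _ <-]]; apply: xV; exists (t, b).
have [|||U [UP Ux]] := unitary_rep_extend (act := act) xf.
- move=> t [s b] [s' b']; rewrite /x /act /= !twisted_star !twistedM.
  rewrite -(hom_star (action_hom t)) !actionM !invgM.
  by rewrite mulgVK mulgA mulgVK.
- by move=> [s b]; rewrite /x /act /= mul1g action1.
- by move=> t t' [s b]; rewrite /x /act /= actionM mulgA.
by exists U; split=> // t s b; exact: (Ux t (s, b)).
Qed.

End CrossedProducts.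

Section SkewProductCrossedProduct.
Context {R : realType} {G : groupType} {E : digraph} {c : edge E -> G}.
Hypothesis E_fin : row_finite E.
Context {A : cstarType R} {s : edge E -> A} {p : vertex E -> A}.
Hypothesis A_graph : is_graph_algebra s p.
Context {B : cstarType R} {s' : edge (skew_product c) -> B}
  {p' : vertex (skew_product c) -> B}.
Hypothesis B_graph : is_graph_algebra s' p'.
Context {gamma : G -> B -> B}.
Hypothesis gammaP : is_action gamma.
Hypothesis gamma_edge : forall (f : edge E) (r t : G),
  gamma t (s' (f, r)) = s' (f, (r * t^-1)%g).
Hypothesis gamma_vertex : forall (v : vertex E) (r t : G),
  gamma t (p' (v, r)) = p' (v, (r * t^-1)%g).

Section MatrixSide.
Context {T : cstarType R} {m : A -> G -> G -> T}.
Hypothesis mP : matrix_system m.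
Hypothesis m_full : closed_span_full (matrix_entries m).

Let m_lin r u : linear (fun a => m a r u). Proof. by case: mP. Qed.
Let m_star a r u : (m a r u)^* = m a^* u r. Proof. by case: mP. Qed.

Lemma skew_family_CK : CK_family (E := skew_product c)
  (fun e => m (s e.1) (c e.1 * e.2)%g e.2) (fun v => m (p v.1) v.2 v.2).
Proof.
have [[sI pP pO sR pS] _ _] := A_graph; split.
- by move=> [f r]; rewrite /partial_isometry m_star !(matrix_mul mP) sI.
- move=> [v r]; have [pp ps] := pP v.
  by split; rewrite ?m_star ?(matrix_mul mP) /= ?pp ?ps.
- move=> [v r] [w u] vw /=; case: (mP) => _ -> _; case: eqP => // ru.
  rewrite pO ?(lin0 (m_lin _ _))// => vw'; apply: vw.
  by rewrite vw' ru.
- by move=> [f r]; rewrite m_star (matrix_mul mP) sR.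
- move=> [v u] nsink; rewrite skew_product_sum.
  have {}nsink : ~ is_sink v by move=> /(skew_product_sink c v u).
  rewrite /= pS//; have Ev := E_fin v.
  rewrite !fsbig_finite// (lin_sum (m_lin u u)); apply: eq_bigr => f _.
  by rewrite m_star (matrix_mul mP) mulgA mulgV mul1g.
Qed.

(** The last clause is covariance, [u_t pi(b) = pi(gamma_t b) u_t], which only has to be checked on
    generators. *)
Lemma skew_covariant_rep : exists U (pi : B -> T),
  [/\ unitary_rep U, star_hom pi,
      forall t a r u, rmul U t (m a r u) = m a r (u * t)%g,
      (forall f r, pi (s' (f, r)) = m (s f) (c f * r)%g r) /\
      (forall v r, pi (p' (v, r)) = m (p v) r r) &
      forall t b, U t (pi b) = rmul U t (pi (gamma t b))].
Proof.
have [U [UP Um]] := matrix_rep mP m_full.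
have [_ _ /(_ T _ _ skew_family_CK)[pi [piH piE piV]]] := B_graph.
have Rm t a r u : rmul U t (m a r u) = m a r (u * t)%g.
  by rewrite /rmul m_star Um invgK m_star cstarK.
exists U, pi; split=> // t b.
have gH := action_hom gammaP; move: b t.
apply: (graph_algebra_ind B_graph
  (W := [set b | forall t, U t (pi b) = rmul U t (pi (gamma t b))])).
- split.
  + apply: closed_subspace_forall => t.
    apply: closed_subspace_eq.
    * by move=> k a b; rewrite (hom_lin piH) (lmul_lin UP).
    * exact: lip_comp (lip_lmul UP t) (lip_hom piH).
    * by move=> k a b; rewrite (hom_lin (gH t)) (hom_lin piH) (rmul_lin UP).
    * exact: lip_comp (lip_rmul UP t) (lip_comp (lip_hom piH) (lip_hom (gH t))).
  + move=> a b ea eb t /=; rewrite (homM (gH t)) !(homM piH) (lmul_mul UP) ea.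
    by rewrite (rmul_lmul UP) eb (rmul_mul UP).
  (* Inserting [u_t u_t^-1] after [pi(gamma_t b)] turns the adjoint relation into the one for
     [b]. *)
  + move=> b eb t /=; rewrite (hom_star (gH t)) !(hom_star piH).
    apply: (can_inj (@cstarK R T)); rewrite lmul_star rmul_star !cstarK.
    rewrite -[pi (gamma t b)](rmul1 UP) -(mulgV t) -(rmulM UP) -eb.
    by rewrite (lmul_rmul UP) (lmulVK UP).
- by move=> [f r] t /=; rewrite gamma_edge !piE /= Um Rm mulgVK mulgA.
- by move=> [v r] t /=; rewrite gamma_vertex !piV /= Um Rm mulgVK.
Qed.

(** The integrated form [b delta_t |-> pi(b) u_t] of the covariant pair. *)
Lemma skew_twisted_hom : exists h : G -> B -> T,
  [/\ twisted_hom gamma h,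
      forall t f r, h t (s' (f, r)) = m (s f) (c f * r)%g (r * t)%g &
      forall t v r, h t (p' (v, r)) = m (p v) r (r * t)%g].
Proof.
have [U [pi [UP piH Rm [piE piV] cov]]] := skew_covariant_rep.
exists (fun t b => rmul U t (pi b)); split; last first.
- by move=> t v r; rewrite piV Rm.
- by move=> t f r; rewrite piE Rm.
split.
- by move=> t k a b; rewrite (hom_lin piH) (rmul_lin UP).
- move=> r t a b; rewrite -(rmul_mul UP) (rmul_lmul UP) cov -(rmul_mul UP).
  by rewrite -(homM piH) (rmulM UP).
- by move=> t a; rewrite rmul_star -(hom_star piH) cov.
Qed.

End MatrixSide.

Section CrossedSide.
Context {D : cstarType R} {j : G -> B -> D}.
Hypothesis jP : twisted_hom gamma j.
Hypothesis j_full :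
  closed_span_full [set j t a | t in [set: G] & a in [set: B]].

(* The candidates for [s_f (x) e_11] and [p_v (x) e_11] in the crossed product,
   read off from [j t s'_(f,r) = s_f (x) e_(c(f) r, r t)]. *)
Lemma corner_family_CK : CK_family
  (fun f => j (c f) (s' (f, (c f)^-1)%g)) (fun v => j 1%g (p' (v, 1%g))).
Proof.
have [[sI pP pO sR pS] _ _] := B_graph; have H1 := twisted_hom1 gammaP jP.
have tt f : j (c f) (s' (f, (c f)^-1)%g) \* (j (c f) (s' (f, (c f)^-1)%g))^* =
    j 1%g (s' (f, (c f)^-1)%g \* (s' (f, (c f)^-1)%g)^*).
  exact: (twisted_mul_star gammaP jP).
split.
- move=> f; rewrite /partial_isometry tt (twistedM jP) mul1g (action1 gammaP).
  by rewrite sI.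
- by move=> v; have [pp ps] := pP (v, 1%g); split;
    rewrite -?(homM H1) -?(hom_star H1) ?pp ?ps.
- move=> v w vw; rewrite -(homM H1) pO ?(lin0 (hom_lin H1))//.
  by move=> [].
- move=> f; rewrite (twisted_star jP) (twistedM jP) mulVg.
  rewrite -(homM (action_hom gammaP _)) sR /= gamma_vertex.
  by rewrite invgK mulVg.
- move=> v nsink; rewrite pS; last by move=> /(skew_product_sink c v 1%g).
  have Ev := E_fin v; rewrite skew_product_sum !fsbig_finite//.
  rewrite (lin_sum (hom_lin H1)); apply: eq_bigr => f _.
  by rewrite mulg1 tt.
Qed.

(** The entry at [(r, v)] is [u_r^-1 psi(a) u_v], with [psi] the corner embedding. Matrix
    multiplication amounts to [psi(a) u_t psi(b) = 0] for [t] other than 1. *)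
Lemma crossed_matrix_system : exists n : A -> G -> G -> D,
  [/\ matrix_system n, closed_span_full (matrix_entries n),
      star_hom (fun a => n a 1%g 1%g),
      forall f, n (s f) 1%g 1%g = j (c f) (s' (f, (c f)^-1)%g) &
      forall v, n (p v) 1%g 1%g = j 1%g (p' (v, 1%g))].
Proof.
have [[_ pP _ _ _] _ /(_ D _ _ corner_family_CK)[psi [psiH psiE psiV]]] :=
  A_graph.
have [[_ _ pO' _ _] _ _] := B_graph; have gH := action_hom gammaP.
have [U [UP Uj]] := twisted_rep gammaP jP j_full.
have Rj t r b : rmul U t (j r b) = j (r * t)%g b.
  rewrite /rmul (twisted_star jP) Uj (twisted_star jP) invgM !invgK.
  by rewrite -!(hom_star (gH _)) cstarK !(actionM gammaP) mulgK mulgV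
    (action1 gammaP).
(* [u_t] carries the vertex projection at level 1 to the one at level [t^-1], which is orthogonal to
   level 1. *)
have orth0 t v w : t != 1%g -> psi (p w) \* U t (psi (p v)) = 0.
  move=> t1; rewrite !psiV Uj (twistedM jP) mul1g mulg1 gamma_vertex.
  rewrite (action1 gammaP) pO' ?(lin0 (twisted_lin jP _))// => -[_ /eqP].
  by rewrite mul1g eq_sym invg_eq1 (negbTE t1).
(* The vanishing spreads from vertices to one factor, then through an adjoint, which inverts [t], to
   the other. *)
have orth t a b : t != 1%g -> psi a \* U t (psi b) = 0.
  move=> t1; apply: (graph_algebra_annihilate E_fin A_graph psiH) => v.
  apply: (can_inj (@cstarK R D)); rewrite cstarM lmul_star (rmul_lmul UP).
  have [_ ps] := pP v; rewrite -!(hom_star psiH) ps cstar0.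
  apply: (graph_algebra_annihilate E_fin A_graph psiH) => w.
  by apply: orth0; rewrite invg_eq1.
pose n a r u := U r^-1%g (rmul U u (psi a)).
have n11 a : n a 1%g 1%g = psi a by rewrite /n invg1 (lmul1 UP) (rmul1 UP).
have nP : matrix_system n.
  split.
  - by move=> r u k a b; rewrite /n (hom_lin psiH) (rmul_lin UP) (lmul_lin UP).
  - move=> a b r u w v; rewrite /n (lmul_rmul UP w^-1%g) -(lmul_mul UP).
    rewrite -(rmul_mul UP) (rmul_lmul UP) -(lmulM UP).
    have [->|uw] := eqVneq u w; first by rewrite mulgV (lmul1 UP) (homM psiH).
    rewrite orth.
      by rewrite (lin0 (rmul_lin UP v)) (lin0 (lmul_lin UP _)).
    by apply: contraNneq uw => /mulg1_eq/invg_inj ->.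
  - move=> a r u; rewrite /n lmul_star invgK rmul_star (hom_star psiH).
    by rewrite (lmul_rmul UP).
have nE t f r : n (s f) (c f * r)%g (r * t)%g = j t (s' (f, r)).
  rewrite /n psiE Rj Uj gamma_edge; congr (j _ (s' (f, _))).
    by rewrite (mulgA (c f)) mulKg.
  by rewrite invgK mulKg.
have nV t v r : n (p v) r (r * t)%g = j t (p' (v, r)).
  rewrite /n psiV Rj Uj gamma_vertex; congr (j _ (p' (v, _))).
    by rewrite mul1g mulKg.
  by rewrite invgK mul1g.
exists n; split=> //; last first.
- by move=> v; rewrite n11 psiV.
- by move=> f; rewrite n11 psiE.
- by split=> [k a b|a b|a]; rewrite !n11;
    [exact: hom_lin|exact: homM|exact: hom_star].
have VA : closed_star_subalgebra (closed_span (matrix_entries n)).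
  have [_ nM nS] := nP.
  have [_ V0 _] := closed_span_subspace (matrix_entries n).
  apply: closed_span_star_subalgebra.
    move=> _ _ [[[a r] u] _ <-] [[[b w] v] _ <-] /=; rewrite nM.
    by case: eqP => // _; apply: sub_closed_span; exists (a \* b, r, v).
  move=> _ [[[a r] u] _ <-] /=; rewrite nS.
  by apply: sub_closed_span; exists (a^*, u, r).
have [VS VM Vst] := VA.
(* All [t] and all [gamma u] are carried along because the adjoint of [j t b] changes [t] and brings
   in the action. *)
have jV : forall b t u, closed_span (matrix_entries n) (j t (gamma u b)).
  apply: (graph_algebra_ind B_graph (W := [set b |
    forall t u, closed_span (matrix_entries n) (j t (gamma u b))])).
  - split.
    + apply: closed_subspace_forall => t; apply: closed_subspace_forall => u.
      apply: (closed_subspace_preimage (f := fun b => j t (gamma u b))) => //.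
        by move=> k a b; rewrite (hom_lin (gH u)) (twisted_lin jP).
      exact: lip_comp (lip_twisted gammaP jP t) (lip_hom (gH u)).
    + move=> a b aV bV t u /=.
      have -> : j t (gamma u (a \* b)) = j 1%g (gamma u a) \* j t (gamma u b).
        by rewrite (twistedM jP) mul1g (action1 gammaP) (homM (gH u)).
      exact: VM.
    + move=> b bV t u /=; rewrite (hom_star (gH u)).
      have -> : j t (gamma u b)^* = (j t^-1%g (gamma (t^-1 * u)%g b))^*.
        rewrite (twisted_star jP) invgK (hom_star (gH t)).
        by rewrite (actionM gammaP) mulgA mulgV mul1g.
      exact: Vst.
  - move=> [f r] t u /=; rewrite gamma_edge -nE; apply: sub_closed_span.
    by exists (s f, (c f * (r * u^-1))%g, (r * u^-1 * t)%g).
  - move=> [v r] t u /=; rewrite gamma_vertex -nV; apply: sub_closed_span.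
    by exists (p v, (r * u^-1)%g, (r * u^-1 * t)%g).
move=> V VSub nsubV; apply: j_full => // _ [t _ [b _ <-]].
by rewrite -[b](action1 gammaP); apply: (jV b t 1%g).
Qed.

End CrossedSide.

Lemma skew_crossed_product_isomorphic (D T : cstarType R) (j : G -> B -> D)
    (m : A -> G -> G -> T) :
  is_full_crossed_product gamma j -> matrix_system m ->
  closed_span_full (matrix_entries m) ->
  (forall a, m a 1%g 1%g = 0 -> a = 0) -> star_isomorphic D T.
Proof.
move=> [jP j_full j_univ] mP m_full m0.
have [h [hP hE hV]] := skew_twisted_hom mP m_full.
have [phi [phiH phij]] := j_univ _ _ hP.
have [n [nP n_full nH nE nV]] := crossed_matrix_system jP j_full.
have phin a : phi (n a 1%g 1%g) = m a 1%g 1%g.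
  have pnH : star_hom (fun a => phi (n a 1%g 1%g)).
    split=> [k x y|x y|x].
    - by rewrite (hom_lin nH) (hom_lin phiH).
    - by rewrite (homM nH) (homM phiH).
    - by rewrite (hom_star nH) (hom_star phiH).
  apply: (graph_algebra_hom_eq A_graph pnH (matrix_diag_hom mP 1%g)) => [f|v].
    by rewrite nE phij hE mulgV mulVg.
  by rewrite nV phij hV mulg1.
have phi0 : forall d, phi d = 0 -> d = 0.
  apply: (matrix_hom_injective nP n_full phiH) => a.
  by rewrite phin; exact: m0.
exists phi; split=> //; apply: (hom_bijective phiH phi0 m_full).
have [rS rM rst] := closed_star_subalgebra_range phiH phi0.
have mr : forall a r u, range phi (m a r u).
  apply: (graph_algebra_ind A_graph (W := [set a |
    forall r u, range phi (m a r u)])).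
  - split.
    + apply: closed_subspace_forall => r; apply: closed_subspace_forall => u.
      apply: (closed_subspace_preimage (f := fun a => m a r u)) => //.
        by case: mP.
      exact: lip_matrix_entry.
    + by move=> a b ar br r u; rewrite -(matrix_mul mP a b r 1%g u); exact: rM.
    + by move=> a ar r u; case: mP => _ _ mS; rewrite -mS; exact: rst.
  - move=> f r u.
    (* Since [j t s'_(f,x)] goes to the entry at [(c(f) x, x t)], solve [c(f) x = r] and
       [x t = u]. *)
    exists (j (r^-1 * c f * u)%g (s' (f, ((c f)^-1 * r)%g))) => //.
    rewrite phij hE; congr (m _ _ _); first by rewrite mulgA mulgV mul1g.
    by rewrite !mulgA mulgK mulVg mul1g.
  - move=> v r u; exists (j (r^-1 * u)%g (p' (v, r))) => //.
    by rewrite phij hV mulgA mulgV mul1g.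
by move=> _ [[[a r] u] _ <-]; exact: mr.
Qed.

End SkewProductCrossedProduct.

Theorem theorem3p1 (R : realType) (G : groupType) (E : digraph)
  (c : edge E -> G) (E_row_finite : row_finite E)
  (* A = C^*(E) *)
  (A : cstarType R) (s : edge E -> A) (p : vertex E -> A)
  (A_graph : is_graph_algebra s p)
  (* B = C^*(E x_c G) *)
  (B : cstarType R) (s' : edge (skew_product c) -> B)
  (p' : vertex (skew_product c) -> B)
  (B_graph : is_graph_algebra s' p')
  (gamma : G -> B -> B) (gamma_action : is_action gamma)
  (gamma_edge : forall (f : edge E) (r t : G),
    gamma t (s' (f, r)) = s' (f, (r * t^-1)%g))
  (gamma_vertex : forall (v : vertex E) (r t : G),
    gamma t (p' (v, r)) = p' (v, (r * t^-1)%g))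
  (* D = B x_gamma G *)
  (D : cstarType R) (j : G -> B -> D)
  (D_crossed : is_full_crossed_product gamma j)
  (* K = K(l^2(G)) *)
  (K : cstarType R) (rho : K -> l2 R G -> l2 R G)
  (K_compact : is_compact_operators rho)
  (* T = C^*(E) (x) K(l^2(G)) *)
  (T : cstarType R) (tens : A -> K -> T)
  (T_tensor : is_tensor_product tens) :
  star_isomorphic D T.

Proof.
have [m [mP m_full m0]] := tensor_matrix_system K_compact T_tensor.
exact: (skew_crossed_product_isomorphic E_row_finite A_graph B_graph
  gamma_action gamma_edge gamma_vertex D_crossed mP m_full m0).
Qed.
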